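(* (a) For every $d \ge 1$, $\dfrac{W_n}{\ln\ln n} \to d-1$ in probability as $n \to \infty$. (b) If $d \ge 2$, then almost surely \[ \liminf_{n\to\infty} \frac{W_n}{\ln\ln n} = d-1 \quad\text{and}\quad \limsup_{n\to\infty} \frac{W_n}{\ln\ln n} = d; \] in particular $W_n = \Theta(\ln\ln n)$ almost surely.
   Context: Fix an integer $d \ge 1$. Let $X^{(1)}, X^{(2)}, \dots$ be i.i.d. random vectors in $\mathbb{R}^d$ with independent Exponential$(1)$ coordinates. For $x,y \in \mathbb{R}^d$ write $x \prec y$ if $x_j<y_j$ for all $j$, $x \le y$ if $x_j \le y_j$ for all $j$, and $x_+ := \sum_j x_j$. The record-setting region at time $n$ is $\mathrm{RS}_n := \{x \in \mathbb{R}^d : 0 \le x,\ x \not\prec X^{(i)} \text{ for all } 1 \le i \le n\}$, and its frontier $F_n$ is the topological boundary of $\mathrm{RS}_n$ relative to $[0,\infty)^d$. Define $F_n^- := \min\{x_+ : x \in F_n\}$, $F_n^+ := \max\{x_+ : x \in F_n\}$, and the width $W_n := F_n^+ - F_n^-$. *)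

(* Defs.v *)
From HB Require Import structures.
From mathcomp Require Import all_boot all_order all_algebra.
From mathcomp Require Import all_classical all_reals all_analysis.
Set Implicit Arguments. Unset Strict Implicit. Unset Printing Implicit Defensive.
Import Order.TTheory GRing.Theory Num.Theory.
Import numFieldNormedType.Exports.
Local Open Scope classical_set_scope.
Local Open Scope ring_scope.

Definition mutually_independent (R : realType) (dT : measure_display)
  (T : measurableType dT) (P : probability T R) (I : eqType)
  (Y : I -> {RV P >-> R}) : Prop :=
  forall (s : seq I) (B : I -> set R), uniq s ->
    (forall i, i \in s -> measurable (B i)) ->
    P [set w | forall i, i \in s -> B i (Y i w)] =
    (\big[*%E/1%E]_(i <- s) P (Y i @^-1` B i))%E.

Definition strictly_below (R : realType) (d : nat) (x y : 'rV[R]_d) : Prop :=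
  forall j : 'I_d, x ord0 j < y ord0 j.

Definition orthant (R : realType) (d : nat) : set 'rV[R]_d :=
  [set x | forall j : 'I_d, 0 <= x ord0 j].

(* record-setting region after n observations pts 0, ..., pts (n-1)
   (pts i is the paper's X^(i+1)) *)
Definition RS (R : realType) (d : nat) (pts : nat -> 'rV[R]_d) (n : nat)
  : set 'rV[R]_d :=
  [set x | @orthant R d x /\ forall i, (i < n)%N -> ~ strictly_below x (pts i)].

Definition rel_boundary (R : realType) (d : nat) (Y A : set 'rV[R]_d)
  : set 'rV[R]_d :=
  Y `&` closure A `&` closure (Y `\` A).

Definition frontier (R : realType) (d : nat) (pts : nat -> 'rV[R]_d) (n : nat) :=
  rel_boundary (@orthant R d) (RS pts n).

Definition coord_sum (R : realType) (d : nat) (x : 'rV[R]_d) : R :=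
  \sum_(j < d) x ord0 j.

(* F_n^- and F_n^+ (min and max are attained since F_n is compact,
   so inf/sup coincide with min/max for n >= 1) *)
Definition Fminus (R : realType) (d : nat) (pts : nat -> 'rV[R]_d) (n : nat) : R :=
  inf [set coord_sum x | x in frontier pts n].
Definition Fplus (R : realType) (d : nat) (pts : nat -> 'rV[R]_d) (n : nat) : R :=
  sup [set coord_sum x | x in frontier pts n].

Definition sample (R : realType) (dT : measure_display) (T : measurableType dT)
  (P : probability T R) (d : nat) (X : nat -> 'I_d -> {RV P >-> R}) (w : T)
  : nat -> 'rV[R]_d :=
  fun i => \row_(j < d) X i j w.

Definition width (R : realType) (dT : measure_display) (T : measurableType dT)
  (P : probability T R) (d : nat) (X : nat -> 'I_d -> {RV P >-> R}) (n : nat)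
  (w : T) : R :=
  Fplus (sample X w) n - Fminus (sample X w) n.

(* Main.v *)
Require Import Defs.
From HB Require Import structures.
From mathcomp Require Import all_boot all_order all_algebra.
From mathcomp Require Import all_classical all_reals all_analysis.
From mathcomp Require Import measurable_realfun lra ring zify.
Import Order.TTheory GRing.Theory Num.Theory.
Import numFieldNormedType.Exports.
Local Open Scope classical_set_scope.
Local Open Scope ring_scope.

(** [Fplus] is the largest coordinate sum of an observation, and [c <= Fminus] iff
    every point of the orthant with coordinate sum below [c] is dominated.
    An observation dominates [x >= 0] with probability [exp (- x_+)]; rounding to the
    integer grid and union bounds then show, at times [n = 2^k], that [Fminus] is within
    [e lnln n] of [ln n], that [Fplus >= ln n + (d - 1 - e) lnln n], and that the
    probability of [Fplus > ln n + s lnln n] is of order [(ln n)^(d - 1 - s)], which tends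
    to [0] for [s > d - 1] and is summable over [k] for [s > d].
    Monotonicity in [n] fills the gaps between powers of two, and the first
    Borel-Cantelli lemma gives the almost sure bounds. That [Fplus] exceeds
    [ln n + (d - e) lnln n] infinitely often follows from independence on the blocks
    [2^k <= i < 2^(2k)], where the expected number of such exceedances is of order
    [k^e]. For [d >= 2] the upper bound on [Fminus] is made summable by testing many
    far apart points of the simplex, which are dominated almost independently. *)

(** * Deterministic geometry of the frontier *)

Section frontier_geometry.
Context {R : realType} {d : nat}.
Implicit Types (x y : 'rV[R]_d) (pts : nat -> 'rV[R]_d).

(** At [n = 2^k] one has [ln n = k ln 2], and [ln ln n] is [ln k] up to a constant, so every
    estimate becomes a power of [k]. Such a power tends to 0 once its exponent is negative but is
    summable only below -1; this unit of exponent is the gap between the limit [d - 1] in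
    probability and the limsup [d]. A single scale [2^k <= i < 2^(k+1)] is expected to hold only
    about [k^(e-1)] sums above [ln n + (d - e) lnln n], hence the blocks of [k] scales. These blocks
    overlap, but no independence between them is used: a failure probability tending to 0 already
    rules out, almost surely, failure on all late blocks. For [Fminus] one test point gives only
    [k^(-e/2)]; using [m] points multiplies that exponent by [m], and spreading them takes two axes.
    For [d = 1] the frontier has at most one point and the width is 0. Events about [Fminus] and
    [Fplus] are estimated through measurable covers. *)

Definition dominated pts n x := exists2 i, (i < n)%N & strictly_below x (pts i).

Lemma RS_P pts n x : RS pts n x <-> orthant x /\ ~ dominated pts n x.
Proof.
split=> -[ox h]; split=> //.
- by move=> [i ilt xi]; exact: h ilt xi.
- by move=> i ilt xi; apply: h; exists i.
Qed.

Lemma not_RS_P pts n x : orthant x -> ~ RS pts n x -> dominated pts n x.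
Proof. by move=> ox h; apply: contrapT => nx; apply: h; apply/RS_P. Qed.

Lemma nbhs_strictly_below x y :
  strictly_below x y -> nbhs x [set z | strictly_below z y].
Proof.
move=> xy.
suff : nbhs x (fun z : 'rV[R]_d => forall j, z ord0 j < y ord0 j) by [].
apply: (@filter_forall _ _
  (fun j (z : 'rV[R]_d) => z ord0 j < y ord0 j) (nbhs x) (nbhs_filter x)) => j.
have cj := @coord_continuous R 1 d ord0 j x.
by apply: (cj [set r | r < y ord0 j]); exact: lt_nbhsl.
Qed.

Lemma nbhs_coord_sum_gt x c :
  c < coord_sum x -> nbhs x [set z | c < coord_sum z].
Proof.
(* Dividing by [d + 1] keeps the total loss [d e] strictly below the gap, also for [d = 0]. *)
move=> cx; pose e := (coord_sum x - c) / d.+1%:R.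
have e0 : 0 < e by rewrite divr_gt0// subr_gt0.
have : nbhs x (fun z : 'rV[R]_d => forall j, x ord0 j - e < z ord0 j).
  apply: (@filter_forall _ _
    (fun j (z : 'rV[R]_d) => x ord0 j - e < z ord0 j) (nbhs x) (nbhs_filter x)) => j.
  have cj := @coord_continuous R 1 d ord0 j x.
  by apply: (cj [set r | x ord0 j - e < r]); apply: lt_nbhsr; lra.
apply: (@filterS _ _ (nbhs_filter x)) => z /= xz.
have : coord_sum x - d%:R * e <= coord_sum z.
  rewrite (_ : d%:R * e = \sum_(j < d) e); last by rewrite sumr_const card_ord mulr_natl.
  by rewrite /coord_sum -sumrB; apply: ler_sum => j _; exact/ltW/xz.
apply: lt_le_trans.
suff : d.+1%:R * e = coord_sum x - c by rewrite -natr1 mulrDl mul1r; lra.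
by rewrite mulrC divfK.
Qed.

Lemma coord_sum_le x y : (forall j, x ord0 j <= y ord0 j) ->
  coord_sum x <= coord_sum y.
Proof. by move=> xy; apply: ler_sum. Qed.

Lemma coord_sum_ge0 x : orthant x -> 0 <= coord_sum x.
Proof. by move=> ox; apply: sumr_ge0 => j _; exact: ox. Qed.

Lemma coord_sumZ (t : R) x : coord_sum (t *: x) = t * coord_sum x.
Proof. by rewrite /coord_sum mulr_sumr; apply: eq_bigr => j _; rewrite mxE. Qed.

Lemma strictly_below_orthant x y j :
  orthant x -> strictly_below x y -> 0 < y ord0 j.
Proof. by move=> ox xy; exact: le_lt_trans (ox j) (xy j). Qed.

Lemma coord_sum_lt x y : (0 < d)%N -> strictly_below x y ->
  coord_sum x < coord_sum y.
Proof.
move=> d0 xy; apply: ltr_sum; last by move=> j _; exact: xy.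
by apply/hasP; exists (Ordinal d0) => //; rewrite mem_index_enum.
Qed.

(** Adherence to the dominated region is only ever tested along a ray from the origin, approached
    from below: this serves both for an observation of maximal sum and for the exit point of a
    segment. *)
Lemma closure_ray pts n x (s : R) : orthant x ->
  (forall e, 0 < e -> exists t, [/\ s - e < t, t <= s, 0 <= t &
     dominated pts n (t *: x)]) ->
  closure (@orthant R d `\` RS pts n) (s *: x).
Proof.
move=> ox h B nB.
have : nbhs s [set t : R | B (t *: x)].
  have /(_ B nB) := @scalel_continuous R _ x s.
  done.
move=> /nbhs_ballP[e /= e0 eB].
have [t [t1 t2 t3 td]] := h e e0.
exists (t *: x); split; last first.
  apply: eB; rewrite /ball/= ger0_norm ?subr_ge0//.
  by rewrite ltrBlDr -ltrBlDl.
split; first by move=> j; rewrite mxE mulr_ge0.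
by move=> /RS_P[].
Qed.

Lemma frontier_not_dominated pts n x :
  frontier pts n x -> orthant x /\ ~ dominated pts n x.
Proof.
move=> [[ox cx] _]; split=> // -[i ilt xi].
have [z [[oz zR] zi]] := cx _ (nbhs_strictly_below _ _ xi).
exact: zR zi.
Qed.

Lemma frontier_sum_lt pts n x c : frontier pts n x -> c < coord_sum x ->
  exists i, [/\ (i < n)%N, strictly_below 0 (pts i) & c < coord_sum (pts i)].
Proof.
move=> [_ cx] cltx.
have nx := nbhs_coord_sum_gt x c cltx.
have [z [[oz zR] cz]] := cx _ nx.
have [i ilt zi] := not_RS_P _ _ _ oz zR.
exists i; split=> //.
- by move=> j; rewrite mxE; exact: strictly_below_orthant zi.
- by apply: lt_le_trans cz _; apply: coord_sum_le => j; exact/ltW/zi.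
Qed.

(** Strict domination increases the sum, so an observation of maximal sum is not dominated, while
    its slight contractions towards 0 are dominated by the observation itself. *)
Lemma sum_max_frontier pts n i : (0 < d)%N ->
  (i < n)%N -> strictly_below 0 (pts i) ->
  (forall k, (k < n)%N -> strictly_below 0 (pts k) ->
     coord_sum (pts k) <= coord_sum (pts i)) ->
  frontier pts n (pts i).
Proof.
move=> d0 ilt pi imax.
have oi : orthant (pts i) by move=> j; move: (pi j); rewrite mxE => /ltW.
split.
- split=> //; apply: subset_closure; apply/RS_P; split=> // -[k klt ik].
  have := imax k klt _; rewrite leNgt coord_sum_lt// => /(_ _)/negP.
  case; first by move=> j; rewrite mxE; exact: strictly_below_orthant ik.
  by [].
- rewrite -(scale1r (pts i)); apply: closure_ray => // e e0.
  (* The maximum with 0 keeps the contracted point in the orthant when [e] is large. *)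
  exists (Num.max 0 (1 - e / 2)); split.
  + by rewrite lt_max; apply/orP; right; lra.
  + by rewrite ge_max; apply/andP; split; lra.
  + by rewrite le_max lexx.
  + exists i => // j; rewrite mxE.
    have := pi j; rewrite mxE => pj.
    by rewrite gtr_pMl// gt_max; apply/andP; split; lra.
Qed.

Lemma exists_sum_max pts n i : (i < n)%N -> strictly_below 0 (pts i) ->
  exists i0, [/\ (i0 < n)%N, strictly_below 0 (pts i0) &
   forall k, (k < n)%N -> strictly_below 0 (pts k) ->
     coord_sum (pts k) <= coord_sum (pts i0)].
Proof.
move=> ilt pi.
have Pi : `[< strictly_below 0 (pts (Ordinal ilt)) >] by apply/asboolP.
case: (@arg_maxP _ _ _ (Ordinal ilt) (fun k : 'I_n => `[< strictly_below 0 (pts k) >])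
  (fun k : 'I_n => coord_sum (pts k)) Pi) => i0 /asboolP pi0 imax.
exists i0; split=> // k klt pk.
by apply: (imax (Ordinal klt)); apply/asboolP.
Qed.

(** Only observations in the open orthant can dominate a point of the orthant, hence the condition
    [strictly_below 0 (pts i)]. The bound [0 <= c] covers the empty frontier, where [sup] takes its
    default value 0. *)
Lemma Fplus_gtP pts n c : (0 < d)%N -> 0 <= c ->
  (c < Fplus pts n <-> exists i,
    [/\ (i < n)%N, strictly_below 0 (pts i) & c < coord_sum (pts i)]).
Proof.
move=> d0 c0; rewrite /Fplus; split.
- have [-> |/set0P S0] := eqVneq [set coord_sum x | x in frontier pts n] set0.
    by rewrite sup0 ltNge c0.
  by move=> /(sup_gt S0)[_ [x fx <-]]; exact: frontier_sum_lt.
- move=> [i [ilt pi ci]].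
  have [i0 [i0lt pi0 imax]] := exists_sum_max _ _ _ ilt pi.
  apply: lt_le_trans ci _; apply: le_trans (imax _ ilt pi) _.
  apply: ub_le_sup; last by exists (pts i0) => //; exact: sum_max_frontier.
  exists (coord_sum (pts i0)) => _ [x fx <-]; rewrite leNgt; apply/negP => h.
  have [k [klt pk]] := frontier_sum_lt _ _ _ _ fx h.
  by rewrite ltNge imax.
Qed.

(** Below any non-dominated [x] lies a frontier point: the segment from 0 to [x] leaves the
    dominated region at one, and sums increase along the segment. Conversely frontier points are
    themselves not dominated. With [0 < c] the empty frontier, whose [inf] is 0 by default, is
    excluded. *)
Lemma Fminus_geP pts n c : (0 < d)%N -> 0 < c ->
  (c <= Fminus pts n <->
   forall x, orthant x -> coord_sum x < c -> dominated pts n x).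
Proof.
move=> d0 c0; split.
- rewrite /Fminus.
  have [-> |/set0P[_ [x0 fx0 _]]] := eqVneq [set coord_sum x | x in frontier pts n] set0.
    by rewrite inf0 leNgt c0.
  move=> cle x ox xc; apply: contrapT => nx.
  (* A nonempty frontier forces an observation in the open orthant; it dominates 0, so the segment
     starts in the dominated region. *)
  have [i [ilt pi _]] : exists i, [/\ (i < n)%N, strictly_below 0 (pts i) &
      coord_sum x0 - 1 < coord_sum (pts i)].
    by apply: frontier_sum_lt fx0 _; lra.
  (* first point of the segment [0, x] that leaves the dominated region *)
  pose S := [set t : R | 0 <= t <= 1 /\ dominated pts n (t *: x)].
  have S0 : S 0.
    by split; [rewrite lexx ler01 | rewrite scale0r; exists i].
  have hS : has_sup S.
    by split; [exists 0|exists 1 => t [/andP[]]].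
  have s0 : 0 <= sup S by apply: ub_le_sup => //; case: hS.
  have s1 : sup S <= 1 by apply: ge_sup; [exists 0|move=> t [/andP[]]].
  have nds : ~ dominated pts n (sup S *: x).
    move=> [k klt sk].
    have sne1 : sup S != 1.
      by apply/eqP => e1; apply: nx; exists k => //; rewrite e1 scale1r in sk.
    have slt1 : sup S < 1 by rewrite lt_neqAle sne1.
    have : nbhs (sup S) [set t : R | strictly_below (t *: x) (pts k)].
      exact: (@scalel_continuous R _ x (sup S) _ (nbhs_strictly_below _ _ sk)).
    move=> /nbhs_ballP[e /= e0 eB].
    (* If the supremum were dominated, openness would allow a further step, capped at the endpoint
       1. *)
    pose t := Num.min 1 (sup S + e / 2).
    have tS : S t.
      split.
        rewrite /t le_min ge_min ler01 lexx /= andbT; lra.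
      exists k => //; apply: eB; rewrite /ball/= ltr_distlC.
      rewrite /t lt_min gt_min; apply/andP; split.
        by apply/andP; split; lra.
      by apply/orP; right; lra.
    have := ub_le_sup (proj2 hS) tS.
    by rewrite leNgt /t lt_min slt1/=; apply/negP; rewrite negbK; lra.
  have fs : frontier pts n (sup S *: x).
    have os : orthant (sup S *: x) by move=> j; rewrite mxE mulr_ge0.
    split; first by split=> //; apply: subset_closure; apply/RS_P.
    apply: closure_ray => // e e0.
    have [t St tlt] := sup_adherent e0 hS.
    exists t; split=> //; first exact: ub_le_sup (proj2 hS) _ St.
      by case: St => /andP[].
    by case: St.
  have : inf [set coord_sum x | x in frontier pts n] <= coord_sum (sup S *: x).
    apply: ge_inf; last by exists (sup S *: x).
    by exists 0 => _ [z /frontier_not_dominated[oz _] <-]; exact: coord_sum_ge0.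
  apply/negP; rewrite -ltNge; apply: lt_le_trans cle; apply: le_lt_trans xc.
  by rewrite coord_sumZ ler_piMl// coord_sum_ge0.
- move=> h.
  have [i ilt pi] : dominated pts n 0.
    apply: h; first by move=> j; rewrite mxE.
    by rewrite /coord_sum big1// => j _; rewrite mxE.
  have [i0 [i0lt pi0 imax]] := exists_sum_max _ _ _ ilt pi.
  apply: lb_le_inf.
    by exists (coord_sum (pts i0)), (pts i0) => //; exact: sum_max_frontier.
  move=> _ [x /frontier_not_dominated[ox nx] <-]; rewrite leNgt; apply/negP => xc.
  by apply: nx; exact: h.
Qed.

Lemma dominated_le pts n m x : (n <= m)%N -> dominated pts n x -> dominated pts m x.
Proof. by move=> nm [i ilt xi]; exists i => //; exact: leq_trans nm. Qed.

Lemma Fplus_ge0 pts n : 0 <= Fplus pts n.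
Proof.
rewrite /Fplus.
have [-> |/set0P[_ [x fx _]]] := eqVneq [set coord_sum x | x in frontier pts n] set0.
  by rewrite sup0.
have [ox _] := frontier_not_dominated _ _ _ fx.
have [ub|nub] := pselect (has_ubound [set coord_sum x | x in frontier pts n]); last first.
  by rewrite sup_out// => -[].
by apply: le_trans (coord_sum_ge0 _ ox) _; apply: ub_le_sup => //; exists x.
Qed.

Lemma Fminus_ge0 pts n : 0 <= Fminus pts n.
Proof.
rewrite /Fminus; have [-> |/set0P S0] := eqVneq [set coord_sum x | x in frontier pts n] set0.
  by rewrite inf0.
by apply: lb_le_inf => // _ [x /frontier_not_dominated[ox _] <-]; exact: coord_sum_ge0.
Qed.

Lemma Fplus_nondecreasing pts n m : (0 < d)%N -> (n <= m)%N ->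
  Fplus pts n <= Fplus pts m.
Proof.
move=> d0 nm; rewrite leNgt; apply/negP => /(Fplus_gtP _ _ _ d0 (Fplus_ge0 _ _)).
move=> [i [ilt pi]]; apply/negP; rewrite -leNgt leNgt; apply/negP => h.
have : Fplus pts m < Fplus pts m.
  by apply/(Fplus_gtP _ _ _ d0 (Fplus_ge0 _ _)); exists i; split=> //; exact: leq_trans nm.
by rewrite ltxx.
Qed.

Lemma Fminus_nondecreasing pts n m : (0 < d)%N -> (n <= m)%N ->
  Fminus pts n <= Fminus pts m.
Proof.
move=> d0 nm; have := Fminus_ge0 pts n; rewrite le_eqVlt => /orP[/eqP <-|n0].
  exact: Fminus_ge0.
apply/Fminus_geP => // x ox xn; apply: (dominated_le _ _ _ _ nm).
by move: x ox xn; apply/Fminus_geP.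
Qed.

(** A countable form of the criterion, meant for measurability: rounding [x] up to a fine enough
    grid keeps the sum below [c], and an observation dominating the rounded point dominates [x]. *)
Lemma Fminus_grid_geP pts n c : (0 < d)%N -> 0 < c ->
  (c <= Fminus pts n <->
   forall (k : nat) (y : {ffun 'I_d -> nat}),
     \sum_j (y j)%:R / k.+1%:R < c ->
     exists2 i, (i < n)%N & forall j, (y j)%:R / k.+1%:R < pts i ord0 j).
Proof.
move=> d0 c0; split.
- move=> /Fminus_geP-/(_ d0 c0) h k y yc.
  have [|| i ilt hi] := h (\row_j ((y j)%:R / k.+1%:R)).
  + by move=> j; rewrite mxE divr_ge0.
  + by rewrite /coord_sum; under eq_bigr do rewrite mxE.
  + by exists i => // j; move: (hi j); rewrite mxE.
- move=> h; apply/Fminus_geP => // x ox xc.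
  (* The mesh [1 / (k + 1)] is so small that rounding up all [d] coordinates costs less than
     [c - x_+]. *)
  pose k := Num.truncn (d%:R / (c - coord_sum x)).
  have cx0 : 0 < c - coord_sum x by rewrite subr_gt0.
  have k0 : 0 < k.+1%:R :> R by [].
  have hk : d%:R / k.+1%:R < c - coord_sum x.
    by rewrite ltr_pdivrMr// mulrC -ltr_pdivrMr//; exact: truncnS_gt.
  pose y : {ffun 'I_d -> nat} := [ffun j => (Num.truncn (x ord0 j * k.+1%:R)).+1].
  have xy j : x ord0 j < (y j)%:R / k.+1%:R.
    by rewrite ltr_pdivlMr// ffunE truncnS_gt.
  have yx j : (y j)%:R / k.+1%:R <= x ord0 j + k.+1%:R^-1.
    rewrite ffunE -natr1 mulrDl mul1r lerD2r ler_pdivrMr// truncn_le.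
    by rewrite mulr_ge0// ox.
  have [|i ilt yi] := h k y.
    apply: le_lt_trans (_ : coord_sum x + d%:R / k.+1%:R < c); last by rewrite -ltrBrDl.
    rewrite /coord_sum (_ : d%:R / k.+1%:R = \sum_(j < d) k.+1%:R^-1); last first.
      by rewrite sumr_const card_ord mulr_natl.
    by rewrite -big_split/=; apply: ler_sum.
  by exists i => // j; exact: lt_trans (xy j) (yi j).
Qed.

End frontier_geometry.

(** * Finite probability calculus and outer bounds *)

Section probability_tools.
Context {R : realType} {dT : measure_display} {T : measurableType dT}.
Variable P : probability T R.
Implicit Types (A B E : set T) (b c : R).

Definition pr A : R := fine (P A).

Lemma prE A : measurable A -> P A = (pr A)%:E.
Proof. by move=> mA; rewrite fineK// fin_num_measure. Qed.

Lemma pr_ge0 A : 0 <= pr A.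
Proof. exact: fine_ge0. Qed.

Lemma le_pr A B : measurable A -> measurable B -> A `<=` B -> pr A <= pr B.
Proof.
move=> mA mB AB; rewrite -lee_fin -!prE//.
by apply: le_measure => //; rewrite inE.
Qed.

Lemma pr_setD A B : measurable A -> measurable B ->
  pr (A `\` B) = pr A - pr (A `&` B).
Proof.
move=> mA mB; apply: EFin_inj; rewrite EFinB -!prE//.
- rewrite measureD//; apply: le_lt_trans (probability_le1 P mA) _.
  by rewrite ltry.
- exact: measurableI.
- exact: measurableD.
Qed.

Lemma pr_setU A B : measurable A -> measurable B -> A `&` B = set0 ->
  pr (A `|` B) = pr A + pr B.
Proof.
move=> mA mB AB; apply: EFin_inj; rewrite EFinD -!prE//; last exact: measurableU.
exact: measureU.
Qed.

Lemma pr_setC A : measurable A -> pr (~` A) = 1 - pr A.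
Proof.
move=> mA; apply: EFin_inj; rewrite EFinB -!prE ?probability_setC//.
exact: measurableC.
Qed.

Lemma measurable_forall_seq (I : eqType) (s : seq I) (A : I -> set T) :
  (forall i, i \in s -> measurable (A i)) ->
  measurable [set w | forall i, i \in s -> A i w].
Proof.
elim: s => [|a s IH] mA.
  by rewrite (_ : mkset _ = setT)//; apply/seteqP; split.
rewrite (_ : mkset _ = A a `&` [set w | forall i, i \in s -> A i w]).
  apply: measurableI; first by apply: mA; rewrite mem_head.
  by apply: IH => i si; apply: mA; rewrite in_cons si orbT.
apply/seteqP; split=> w /= => [h|[wa h] i].
  by split=> [|i si]; apply: h; rewrite in_cons ?eqxx// si orbT.
by rewrite in_cons => /predU1P[->|] //; exact: h.
Qed.

Lemma measurable_exists_seq (I : eqType) (s : seq I) (A : I -> set T) :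
  (forall i, i \in s -> measurable (A i)) ->
  measurable [set w | exists2 i, i \in s & A i w].
Proof.
move=> mA; rewrite (_ : mkset _ = ~` [set w | forall i, i \in s -> (~` A i) w]).
  by apply/measurableC/measurable_forall_seq => i /mA; exact: measurableC.
apply/seteqP; split=> w /= => [[i si wi] h|].
  exact: h _ si wi.
by apply: contra_notP => h i si wi; apply: h; exists i.
Qed.

(** By disjointness, removing one [A v] does not touch the part of [E] inside the others, so no
    inclusion-exclusion terms arise. *)
Lemma pr_avoid E (V : eqType) (r : seq V) (A : V -> set T) :
  measurable E -> (forall v, measurable (A v)) -> uniq r ->
  (forall v v' w, v != v' -> A v w -> ~ A v' w) ->
  pr [set w | E w /\ forall v, v \in r -> ~ A v w] =
  pr E - \sum_(v <- r) pr (E `&` A v).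
Proof.
move=> mE mA + dA; elim: r => [_|a r IH /= /andP[ar ur]].
  rewrite big_nil subr0; congr pr.
  by apply/seteqP; split=> w //= -[].
pose S := [set w | E w /\ forall v, v \in r -> ~ A v w].
have mS : measurable S.
  apply: measurableI => //; apply: measurable_forall_seq => v _.
  exact: measurableC.
rewrite (_ : mkset _ = S `\` A a); last first.
  apply/seteqP; split=> w /= => [[Ew h]|[[Ew h] na]].
    split; last by apply: h; rewrite mem_head.
    by split=> // v vr; apply: h; rewrite in_cons vr orbT.
  by split=> // v; rewrite in_cons => /predU1P[->|/h].
rewrite pr_setD// (_ : S `&` A a = E `&` A a); last first.
  apply/seteqP; split=> w /= => [[[]]|[Ew Aw]]//.
  split=> //; split=> // v vr; apply: dA Aw.
  by apply: contraNneq ar => ->.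
by rewrite IH// big_cons; ring.
Qed.

(* An upper bound on the outer probability: it does not require [A] to be measurable. *)
Definition prob_le A b :=
  exists A', [/\ measurable A', A `<=` A' & (P A' <= b%:E)%E].

Lemma prob_leS A B b : A `<=` B -> prob_le B b -> prob_le A b.
Proof. by move=> AB [C [mC BC Cb]]; exists C; split=> //; exact: subset_trans BC. Qed.

Lemma prob_leW A b c : b <= c -> prob_le A b -> prob_le A c.
Proof.
move=> bc [C [mC AC Cb]]; exists C; split=> //.
by apply: le_trans Cb _; rewrite lee_fin.
Qed.

Lemma prob_le_measurable A b : measurable A -> pr A <= b -> prob_le A b.
Proof. by move=> mA Ab; exists A; split=> //; rewrite prE// lee_fin. Qed.

Lemma prob_leP A b : measurable A -> prob_le A b -> (P A <= b%:E)%E.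
Proof.
move=> mA [B [mB AB Bb]]; apply: le_trans Bb.
by apply: le_measure => //; rewrite inE.
Qed.

Lemma prob_leU A B b c : prob_le A b -> prob_le B c -> prob_le (A `|` B) (b + c).
Proof.
move=> [A' [mA AA' Ab]] [B' [mB BB' Bc]].
exists (A' `|` B'); split; [exact: measurableU|exact: setUSS|].
by apply: le_trans (measureU2 P mA mB) _; rewrite EFinD leeD.
Qed.

Lemma prob_le0 : prob_le set0 0.
Proof. by exists set0; split=> //; rewrite measure0. Qed.

Lemma prob_le_bigU (I : eqType) (s : seq I) (A : I -> set T) (b : I -> R) :
  (forall i, i \in s -> prob_le (A i) (b i)) ->
  prob_le [set w | exists2 i, i \in s & A i w] (\sum_(i <- s) b i).
Proof.
elim: s => [|a s IH] h.
  by rewrite big_nil; apply: prob_leS prob_le0 => w [].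
rewrite big_cons; apply: (@prob_leS _ (A a `|` [set w | exists2 i, i \in s & A i w])).
  move=> w [i]; rewrite in_cons => /predU1P[->|si] Aw; [by left|by right; exists i].
apply: prob_leU; first by apply: h; rewrite mem_head.
by apply: IH => i si; apply: h; rewrite in_cons si orbT.
Qed.

Lemma prob_le_exists (I : finType) (A : I -> set T) b :
  (forall i, prob_le (A i) b) ->
  prob_le [set w | exists i, A i w] (#|I|%:R * b).
Proof.
move=> h; rewrite mulr_natl (_ : b *+ _ = \sum_(i <- enum I) b).
  apply: prob_leS (prob_le_bigU _ (enum I) A (fun=> b) _) => //.
  by move=> w [i Ai]; exists i; rewrite ?mem_enum.
by rewrite big_const_seq count_predT -cardE iter_addr_0.
Qed.


End probability_tools.

(** * Independent exponential coordinates and avoidance of boxes *)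

Section exponential_sample.
Context {R : realType} {d : nat} {dT : measure_display} {T : measurableType dT}
  {P : probability T R} {X : nat -> 'I_d -> {RV P >-> R}}.
Hypothesis indepX : mutually_independent (fun ij : nat * 'I_d => X ij.1 ij.2).
Hypothesis expX : forall (i : nat) (j : 'I_d) (A : set R), measurable A ->
  distribution P (X i j) A = exponential_prob (1 : R) A.

Lemma measurable_preX i j (A : set R) : measurable A -> measurable (X i j @^-1` A).
Proof. by move=> mA; rewrite -[X in measurable X]setTI; exact: measurable_funP. Qed.

Lemma prob_preX i j (A : set R) : measurable A ->
  P (X i j @^-1` A) = exponential_prob (1 : R) A.
Proof. by move=> mA; rewrite -(expX i j). Qed.

Lemma pr_X_lt0 i j : pr P (X i j @^-1` `]-oo, (0 : R)[) = 0.
Proof.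
rewrite /pr prob_preX// (_ : exponential_prob _ _ = 0%E)//.
apply: integral0_eq => x /=; rewrite in_itv/= => x0.
by rewrite lt0_exponential_pdf.
Qed.

Lemma pr_X_gt i j (a : R) : 0 <= a -> pr P (X i j @^-1` `]a, +oo[) = expR (- a).
Proof.
have pos (b : R) : 0 < b -> pr P (X i j @^-1` `]b, +oo[) = expR (- b).
  move=> b0.
  have -> : X i j @^-1` `]b, +oo[ =
      ~` (X i j @^-1` `]-oo, (0 : R)[ `|` X i j @^-1` `[(0 : R), b]).
    apply/seteqP; split=> w /=; rewrite !in_itv/= andbT.
      by move=> bw [|/andP[]]; [have := lt_trans b0 bw; lra|move=> _; lra].
    by move=> /not_orP[/negP h1 /negP h2]; move: h1 h2; rewrite -leNgt => ->/=; rewrite -ltNge.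
  rewrite pr_setC; last by apply: measurableU; exact: measurable_preX.
  rewrite pr_setU; [|exact: measurable_preX|exact: measurable_preX|].
    rewrite pr_X_lt0 add0r /pr prob_preX// exponential_prob_itv0c// mulN1r/=.
    by ring.
  apply/seteqP; split=> w //=; rewrite !in_itv/= => -[h1 /andP[h2 _]]; lra.
rewrite le_eqVlt => /predU1P[<-|]; last exact: pos.
rewrite oppr0 expR0; apply/eqP; rewrite eq_le; apply/andP; split.
  by rewrite -lee_fin -prE; [apply: probability_le1|]; exact: measurable_preX.
rewrite leNgt; apply/negP => p1.
(* The case [a = 0] is a limit of positive ones: with [2 b] the supposed defect,
   [1 - b <= exp (- b) <= 1 - 2 b] is absurd. *)
pose b := (1 - pr P (X i j @^-1` `]0, +oo[)) / 2.
have b0 : 0 < b by rewrite /b; lra.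
have : pr P (X i j @^-1` `]b, +oo[) <= pr P (X i j @^-1` `]0, +oo[).
  apply: le_pr; [exact: measurable_preX..|move=> w /=]; rewrite !in_itv/= !andbT.
  exact: lt_trans.
rewrite pos//; have := expR_ge1Dx (- b); rewrite /b; lra.
Qed.

Lemma pr_X_cell i j (a : R) : 0 <= a ->
  pr P (X i j @^-1` `]a, a + 1]) = expR (- a) * (1 - expR (-1)).
Proof.
move=> a0.
have -> : X i j @^-1` `]a, a + 1] = X i j @^-1` `]a, +oo[ `\` X i j @^-1` `]a + 1, +oo[.
  apply/seteqP; split=> w /=; rewrite !in_itv/= !andbT.
    by move=> /andP[-> h]; split=> //; apply/negP; rewrite -leNgt.
  by move=> [-> /negP]; rewrite -leNgt.
rewrite pr_setD; [|exact: measurable_preX..].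
rewrite setIidr; last first.
  by move=> w /=; rewrite !in_itv/= !andbT; apply: lt_trans; lra.
by rewrite !pr_X_gt//; [rewrite opprD expRD; ring|lra].
Qed.

Definition box i (B : 'I_d -> set R) := [set w | forall j, B j (X i j w)].

Lemma measurable_box i B : (forall j, measurable (B j)) -> measurable (box i B).
Proof.
move=> mB; rewrite (_ : box i B = [set w | forall j, j \in enum 'I_d -> (X i j @^-1` B j) w]).
  by apply: measurable_forall_seq => j _; exact: measurable_preX.
by apply/seteqP; split=> w /= h j; [move=> _; exact: h|exact: h (mem_enum _ _)].
Qed.

Lemma pr_boxes_coord (s : seq nat) (B : nat -> 'I_d -> set R) :
  uniq s -> (forall i j, measurable (B i j)) ->
  pr P [set w | forall i, i \in s -> box i (B i) w] =
  \prod_(i <- s) \prod_j pr P (X i j @^-1` B i j).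
Proof.
move=> us mB.
pose r := [seq (i, j) | i <- s, j <- enum 'I_d].
have ur : uniq r.
  by apply: allpairs_uniq => //; [exact: enum_uniq|move=> [? ?] [? ?]].
have := indepX r (fun ij => B ij.1 ij.2) ur (fun ij _ => mB ij.1 ij.2).
rewrite (_ : mkset _ = [set w | forall i, i \in s -> box i (B i) w]); last first.
  apply/seteqP; split=> w /= h.
    move=> i si j; apply: (h (i, j)); apply/allpairsP.
    by exists (i, j); split; rewrite ?mem_enum.
  by move=> [i j] /allpairsP[[i' j'] /= [si' _ [-> ->]]]; exact: h.
rewrite /pr => ->; rewrite big_allpairs_dep/=.
rewrite (eq_bigr (fun i => (\prod_j pr P (X i j @^-1` B i j))%:E)) ?prodEFin//.
move=> i _; rewrite -prodEFin big_enum/=; apply: eq_bigr => j _.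
by rewrite prE//; exact: measurable_preX.
Qed.

Lemma pr_box i B : (forall j, measurable (B j)) ->
  pr P (box i B) = \prod_j pr P (X i j @^-1` B j).
Proof.
move=> mB; have := pr_boxes_coord [:: i] (fun=> B) isT (fun=> mB).
rewrite big_seq1 => <-; congr pr; apply/seteqP; split=> w /= h.
  by move=> k; rewrite inE => /eqP ->.
exact: h (mem_head _ _).
Qed.

Lemma pr_boxes (s : seq nat) (B : nat -> 'I_d -> set R) :
  uniq s -> (forall i j, measurable (B i j)) ->
  pr P [set w | forall i, i \in s -> box i (B i) w] =
  \prod_(i <- s) pr P (box i (B i)).
Proof.
move=> us mB; rewrite pr_boxes_coord//; apply: eq_bigr => i _.
by rewrite pr_box.
Qed.

(* Boxes are kept on an auxiliary index list so that, peeling off an index [a],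
   the events [avoid \cap box a] are again of the same form. *)
Lemma pr_avoid_boxes_gen (V : finType) (B : nat -> V -> 'I_d -> set R)
    (s s' : seq nat) (C : nat -> 'I_d -> set R) :
  (forall i v j, measurable (B i v j)) ->
  (forall i v v' w, v != v' -> box i (B i v) w -> ~ box i (B i v') w) ->
  (forall i j, measurable (C i j)) -> uniq (s ++ s') ->
  pr P [set w | (forall i, i \in s' -> box i (C i) w) /\
     forall i, i \in s -> forall v, ~ box i (B i v) w] =
  (\prod_(i <- s) (1 - \sum_v pr P (box i (B i v)))) *
  \prod_(i <- s') pr P (box i (C i)).
Proof.
move=> mB dB; elim: s s' C => [|a s IH] s' C mC.
  move=> us'; rewrite big_nil mul1r -pr_boxes//; congr pr.
  by apply/seteqP; split=> w //= -[].
rewrite cat_cons cons_uniq => /andP[ass' us].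
pose E := [set w | (forall i, i \in s' -> box i (C i) w) /\
     forall i, i \in s -> forall v, ~ box i (B i v) w].
have mE : measurable E.
  apply: measurableI; apply: measurable_forall_seq => i _; first exact: measurable_box.
  rewrite (_ : (fun w => _) = [set w | forall v, v \in enum V -> ~ box i (B i v) w]).
    by apply: measurable_forall_seq => v _; apply: measurableC; exact: measurable_box.
  apply/seteqP; split=> w /= h v; first by move=> _; exact: h.
  exact: h (mem_enum _ _).
rewrite (_ : mkset _ =
  [set w | E w /\ forall v, v \in enum V -> ~ box a (B a v) w]); last first.
  apply/seteqP; split=> w /= => [[h1 h2]|[[h1 h2] h3]].
    split; first by split=> // i si; apply: h2; rewrite in_cons si orbT.
    by move=> v _; apply: h2; rewrite mem_head.
  split=> // i; rewrite in_cons => /predU1P[-> v|]; last exact: h2.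
  exact: h3 (mem_enum _ _).
rewrite pr_avoid ?enum_uniq//; last first.
- by move=> v v' w; exact: dB.
- by move=> v; exact: measurable_box.
have step v : pr P (E `&` box a (B a v)) = pr P E * pr P (box a (B a v)).
  pose C' i := if i == a then B a v else C i.
  have := IH (a :: s') C' _ _.
  rewrite (_ : mkset _ = E `&` box a (B a v)); last first.
    apply/seteqP; split=> w /= => [[h1 h2]|[[h1 h2] h3]].
      split; last by have := h1 a (mem_head _ _); rewrite /C' eqxx.
      split=> // i si; have := h1 i; rewrite in_cons si orbT /C' => /(_ isT).
      case: eqP => // ia _; move: ass'; rewrite -ia mem_cat si orbT//.
    split=> // i; rewrite in_cons /C'; case: eqP => [-> _//|_ /= si].
    exact: h1.
  move=> ->; first last.
  - by rewrite -cat1s uniq_catCA cat_cons cons_uniq ass'.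
  - by move=> i j; rewrite /C'; case: ifP.
  rewrite big_cons {1}/C' eqxx.
  have -> : \prod_(i <- s') pr P (box i (C' i)) = \prod_(i <- s') pr P (box i (C i)).
    apply: eq_big_seq => i si; rewrite /C'; case: eqP => // ia.
    by move: ass'; rewrite -ia mem_cat si orbT.
  by rewrite /E IH//; ring.
rewrite (eq_bigr (fun v => pr P E * pr P (box a (B a v)))); last first.
  by move=> v _; exact: step.
rewrite -mulr_sumr big_enum/= [in LHS]/E IH// big_cons; ring.
Qed.

Lemma pr_avoid_boxes (V : finType) (B : nat -> V -> 'I_d -> set R) (s : seq nat) :
  (forall i v j, measurable (B i v j)) ->
  (forall i v v' w, v != v' -> box i (B i v) w -> ~ box i (B i v') w) ->
  uniq s ->
  pr P [set w | forall i, i \in s -> forall v, ~ box i (B i v) w] =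
  \prod_(i <- s) (1 - \sum_v pr P (box i (B i v))).
Proof.
move=> mB dB us.
have := pr_avoid_boxes_gen V B s [::] (fun _ _ => setT) mB dB.
rewrite cats0 big_nil mulr1 => <-//; congr pr.
by apply/seteqP; split=> w // -[].
Qed.

(** Probabilities of disjoint boxes add within one observation, independence multiplies over
    observations, and [1 - p <= exp (- p)] turns the product into the exponential of minus the
    expected number of hits. *)
Lemma prob_le_avoid_boxes (V : finType) (B : nat -> V -> 'I_d -> set R) (s : seq nat)
    (b : nat -> R) :
  (forall i v j, measurable (B i v j)) ->
  (forall i v v' w, v != v' -> box i (B i v) w -> ~ box i (B i v') w) ->
  (forall i, i \in s -> b i <= \sum_v pr P (box i (B i v))) ->
  uniq s ->
  prob_le P [set w | forall i, i \in s -> forall v, ~ box i (B i v) w]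
    (expR (- \sum_(i <- s) b i)).
Proof.
move=> mB dB hb us.
have mbox i v : measurable (box i (B i v)) by exact: measurable_box.
have mav (r : seq V) i : measurable [set w | forall v, v \in r -> ~ box i (B i v) w].
  by apply: measurable_forall_seq => v _; exact: measurableC.
apply: prob_le_measurable.
  apply: measurable_forall_seq => i _.
  rewrite (_ : (fun w => _) = [set w | forall v, v \in enum V -> ~ box i (B i v) w])//.
  apply/seteqP; split=> w /= h v; first by move=> _; exact: h.
  exact: h (mem_enum _ _).
rewrite pr_avoid_boxes// -sumrN expR_sum big_seq_cond [leRHS]big_seq_cond.
apply: ler_prod => i /andP[si _]; apply/andP; split; last first.
  by apply: le_trans (expR_ge1Dx _); have := hb i si; lra.
(* Each factor is nonnegative because it is itself a probability, that of avoiding all boxes of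
   observation [i]. *)
have := pr_avoid_boxes V B [:: i] mB dB isT; rewrite big_seq1 => <-.
exact: pr_ge0.
Qed.

Definition exceed i (y : 'I_d -> R) := box i (fun j => `]y j, +oo[%classic).

Lemma exceedP i y w : exceed i y w <-> forall j, y j < X i j w.
Proof. by split=> h j; have := h j; rewrite /= in_itv/= andbT. Qed.

Lemma measurable_exceed i y : measurable (exceed i y).
Proof. exact: measurable_box. Qed.

Lemma pr_exceed i y : (forall j, 0 <= y j) ->
  pr P (exceed i y) = expR (- \sum_j y j).
Proof.
move=> y0; rewrite pr_box// -sumrN expR_sum; apply: eq_bigr => j _.
by rewrite pr_X_gt.
Qed.

Lemma prob_le_exceed i y : (forall j, 0 <= y j) ->
  prob_le P (exceed i y) (expR (- \sum_j y j)).
Proof.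
by move=> y0; apply: prob_le_measurable; [exact: measurable_exceed|rewrite pr_exceed].
Qed.

End exponential_sample.

(** * Rounding strictly down to integers *)

Section nat_below.
Context {R : realType}.

(** Differs from [Num.truncn] only at positive integers: the events [exceed] are strict, so the grid
    value must be strictly below [x] yet within 1 of it. *)
Definition nat_below (x : R) : nat :=
  if (Num.truncn x)%:R == x then (Num.truncn x).-1 else Num.truncn x.

Lemma nat_belowP (x : R) : 0 < x -> (nat_below x)%:R < x <= (nat_below x)%:R + 1.
Proof.
move=> x0; have /andP[h1 h2] := truncn_itv (ltW x0).
rewrite /nat_below; case: eqP => [e|/eqP ne].
  have t0 : (0 < Num.truncn x)%N by rewrite -(ltr0n R) e.
  rewrite natr1 prednK// e lexx andbT -[ltRHS]e ltr_nat.
  by rewrite prednK.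
by rewrite lt_neqAle ne h1/= natr1 ltW.
Qed.

End nat_below.

(** * Union bounds for the frontier at a fixed time *)

Section frontier_bounds.
Context {R : realType} {d' : nat} {dT : measure_display} {T : measurableType dT}
  {P : probability T R}.
Local Notation d := d'.+1.
Context {X : nat -> 'I_d -> {RV P >-> R}}.
Hypothesis indepX : mutually_independent (fun ij : nat * 'I_d => X ij.1 ij.2).
Hypothesis expX : forall (i : nat) (j : 'I_d) (A : set R), measurable A ->
  distribution P (X i j) A = exponential_prob (1 : R) A.

Lemma sampleE w i j : sample X w i ord0 j = X i j w.
Proof. by rewrite mxE. Qed.

Lemma dominated_sample w n (x : 'rV[R]_d) : dominated (sample X w) n x <->
  exists2 i, (i < n)%N & exceed (X := X) i (x ord0) w.
Proof.
split=> -[i ilt h]; exists i => //.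
  by apply/exceedP => j; have := h j; rewrite sampleE.
by move=> j; rewrite sampleE; move/exceedP: h.
Qed.

(** A non-dominated point of sum below [c], rounded up to integers, remains non-dominated and has
    sum at most [c + d]. Each such integer point escapes all [n] observations with probability at
    most [exp (- n e^(-(c + d)))]. *)
Lemma prob_Fminus_lt n (c : R) : 0 < c ->
  prob_le P [set w | Fminus (sample X w) n < c]
    ((Num.truncn c).+2%:R ^+ d * expR (- (n%:R * expR (- (c + d%:R))))).
Proof.
(* Coordinates are at most [c], so rounded up they range over [0, ..., truncn c + 1]. *)
move=> c0; pose K := (Num.truncn c).+2.
(* Grid points of too large a sum get the empty event; [unit] indexes the single box that each
   observation has to avoid. *)
pose A (y : {ffun 'I_d -> 'I_K}) := [set w | \sum_j (y j)%:R <= c + d%:R /\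
  forall i, i \in iota 0 n -> forall v : unit, ~ exceed (X := X) i (fun j => (y j)%:R) w].
rewrite -natrX -[(_ ^ d)%N](_ : #|{ffun 'I_d -> 'I_K}| = _); last first.
  by rewrite card_ffun !card_ord.
apply: prob_leS (prob_le_exists _ _ A _ _).
- move=> w /= Fc.
  have [x [ox xc nx]] : exists x, [/\ orthant x, coord_sum x < c &
      ~ dominated (sample X w) n x].
    move: Fc; rewrite ltNge => /negP; apply: contra_notP => /forallNP h.
    apply/Fminus_geP => // x ox xc; apply: contrapT => nx; apply: (h x).
    by split.
  have xle j : x ord0 j <= coord_sum x.
    rewrite /coord_sum (bigD1 j)//= lerDl; apply: sumr_ge0 => k _; exact: ox.
  have yK j : ((Num.truncn (x ord0 j)).+1 < K)%N.
    by rewrite /K !ltnS; apply: le_truncn; apply/ltW/(le_lt_trans (xle j)).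
  exists [ffun j => Ordinal (yK j)]; split.
    apply: le_trans (_ : coord_sum x + d%:R <= _); last by rewrite lerD2r ltW.
    rewrite [d in d%:R](_ : _ = \sum_(j < d) 1)%N; last by rewrite sum1_card card_ord.
    rewrite natr_sum /coord_sum -big_split/=; apply: ler_sum => j _.
    by rewrite ffunE/= -natr1 lerD2r truncn_le.
  move=> i; rewrite mem_iota/= add0n => ilt _ /exceedP h; apply: nx.
  apply/dominated_sample; exists i => //; apply/exceedP => j.
  by apply: lt_trans (h j); rewrite ffunE/= truncnS_gt.
- move=> y; have [ys|ys] := leP (\sum_j (y j)%:R) (c + d%:R); last first.
    apply: (@prob_leS _ _ _ _ _ set0); first by move=> w [/=]; rewrite leNgt ys.
    by apply: prob_leW (prob_le0 P); exact: expR_ge0.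
  apply: prob_leS (_ : prob_le P [set w | forall i, i \in iota 0 n ->
    forall v : unit, ~ exceed (X := X) i (fun j => (y j)%:R) w] _).
    by move=> w [].
  have -> : n%:R * expR (- (c + d%:R)) = \sum_(i <- iota 0 n) expR (- (c + d%:R)) :> R.
    by rewrite big_const_seq count_predT size_iota iter_addr_0 mulr_natl.
  apply: (prob_le_avoid_boxes indepX unit (fun _ _ j => `](y j)%:R, +oo[%classic)
      (iota 0 n) (fun=> expR (- (c + d%:R)))).
  + by [].
  + by move=> i [] [].
  + move=> i _; rewrite (bigD1 tt)//= big1; last by case.
    by rewrite addr0 (pr_exceed indepX expX)// ler_expR lerN2.
  + exact: iota_uniq.
Qed.

(** Injectivity makes the [m] events concern distinct, hence independent, observations. *)
Lemma prob_le_exceed_inj m (f : 'I_m -> nat) (x : 'I_m -> 'I_d -> R) :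
  injective f -> (forall a j, 0 <= x a j) ->
  prob_le P [set w | forall a, exceed (X := X) (f a) (x a) w]
    (expR (- \sum_a \sum_j x a j)).
Proof.
move=> injf x0.
(* Thresholds are re-indexed by observation; 0 is a filler outside the image of [f]. *)
pose y (i : nat) (j : 'I_d) := if [pick a | f a == i] is Some a then x a j else 0.
have yf a : y (f a) = x a.
  apply/funext => j; rewrite /y; case: pickP => [b /eqP/injf -> //|/(_ a)].
  by rewrite eqxx.
have uf : uniq [seq f a | a <- enum 'I_m] by rewrite map_inj_uniq// enum_uniq.
rewrite (_ : mkset _ = [set w | forall i, i \in [seq f a | a <- enum 'I_m] ->
    exceed (X := X) i (y i) w]); last first.
  apply/seteqP; split=> w /= h.
    by move=> _ /mapP[a _ ->]; rewrite yf.
  by move=> a; rewrite -yf; apply: h; apply: map_f; rewrite mem_enum.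
apply: prob_le_measurable.
  by apply: measurable_forall_seq => i _; exact: measurable_exceed.
rewrite (pr_boxes indepX _ (fun i j => `]y i j, +oo[%classic))// big_map.
rewrite -sumrN expR_sum big_enum/=; apply: ler_prod => a _.
rewrite pr_ge0/= yf (pr_exceed indepX expX)//.
Qed.

(* Either the [m] points are dominated by distinct observations, or one
   observation dominates the join of two of them. *)
Lemma prob_all_dominated n m (x : 'I_m -> 'I_d -> R) (M : R) :
  (forall a j, 0 <= x a j) ->
  (forall a b, a != b -> M <= \sum_j Num.max (x a j) (x b j)) ->
  prob_le P [set w | forall a, exists2 i, (i < n)%N & exceed (X := X) i (x a) w]
    (n%:R ^+ m * expR (- \sum_a \sum_j x a j) +
     (m * m * n)%:R * expR (- M)).
Proof.
move=> x0 hM.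
pose A (f : {ffun 'I_m -> 'I_n}) :=
  [set w | injective f /\ forall a, exceed (X := X) (f a) (x a) w].
pose B (p : 'I_m * 'I_m * 'I_n) := [set w | p.1.1 != p.1.2 /\
  exceed (X := X) p.2 (fun j => Num.max (x p.1.1 j) (x p.1.2 j)) w].
apply: (@prob_leS _ _ _ _ _ ([set w | exists f, A f w] `|` [set w | exists p, B p w])).
  move=> w /= h.
  have h' a : exists i : 'I_n, exceed (X := X) i (x a) w.
    by have [i ilt hi] := h a; exists (Ordinal ilt).
  have [f hf] := choice h'.
  have [injf|ninj] := pselect (injective f).
    left; exists [ffun a => f a]; split; last by move=> a; rewrite ffunE.
    by move=> a b; rewrite !ffunE; exact: injf.
  right; have [a [b [fab nab]]] : exists a b, f a = f b /\ a != b.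
    apply: contra_notP ninj => nex a b fab; apply: contrapT => nab.
    by apply: nex; exists a, b; split=> //; apply/eqP.
  exists (a, b, f a); split=> //=; apply/exceedP => j.
  move/exceedP: (hf a) => ha; have := hf b; rewrite -fab => /exceedP hb.
  by rewrite gt_max ha hb.
apply: prob_leU.
- rewrite -natrX (_ : (n ^ m)%N = #|{ffun 'I_m -> 'I_n}|); last first.
    by rewrite card_ffun !card_ord.
  apply: prob_le_exists => f; have [injf|ninj] := pselect (injective f); last first.
    apply: (@prob_leS _ _ _ _ _ set0); first by move=> w [].
    by apply: prob_leW (prob_le0 P); exact: expR_ge0.
  apply: prob_leS (prob_le_exceed_inj m (fun a => f a) x _ x0); first by move=> w [].
  by move=> a b /ord_inj/injf.
- rewrite (_ : (m * m * n)%N = #|{: 'I_m * 'I_m * 'I_n}|); last first.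
    by rewrite !card_prod !card_ord.
  apply: prob_le_exists => -[[a b] i]; have [/eqP ab|nab] := boolP (a == b).
    apply: (@prob_leS _ _ _ _ _ set0); first by move=> w [/=]; rewrite ab eqxx.
    by apply: prob_leW (prob_le0 P); exact: expR_ge0.
  apply: (@prob_leS _ _ _ _ _ (exceed (X := X) i (fun j => Num.max (x a j) (x b j)))).
    by move=> w [].
  apply: prob_leW (prob_le_exceed indepX expX _ _ _).
    by rewrite ler_expR lerN2 hM.
  by move=> j; rewrite le_max x0.
Qed.

(* All coordinates but the first are rounded down to the grid, capped at [b];
   the threshold of the first coordinate makes up for the rest of [t - d']. *)
Lemma prob_Fplus_gt n (t : R) (b : nat) : 0 <= t -> t - d'%:R <= b%:R ->
  prob_le P [set w | t < Fplus (sample X w) n]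
    (n%:R * (b.+1%:R ^+ d' * expR (- (t - d'%:R)))).
Proof.
move=> t0 tb; set M := t - d'%:R in tb *.
pose V := {ffun 'I_d' -> 'I_b.+1}.
pose y (z : V) (j : 'I_d) : R := if unlift ord0 j is Some k then (z k)%:R
  else Num.max 0 (M - \sum_k (z k)%:R).
have y0 z j : 0 <= y z j by rewrite /y; case: unlift => [k //|]; rewrite le_max lexx.
have sy z : M <= \sum_j y z j.
  rewrite big_ord_recl {1}/y unlift_none [X in _ + X](eq_bigr (fun k => (z k)%:R)); last first.
    by move=> k _; rewrite /y liftK.
  by rewrite -lerBlDr le_max lexx orbT.
have cardV : b.+1%:R ^+ d' = #|V|%:R :> R by rewrite -natrX card_ffun !card_ord.
rewrite cardV [n in n%:R](_ : _ = #|'I_n|); last by rewrite card_ord.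
pose A (i : 'I_n) := [set w | exists z, exceed (X := X) i (y z) w].
apply: prob_leS (prob_le_exists _ _ A _ _); last first.
  move=> i; apply: prob_le_exists => z.
  by apply: prob_leW (prob_le_exceed indepX expX _ _ (y0 z)); rewrite ler_expR lerN2.
move=> w /= /Fplus_gtP-/(_ isT t0)[i [ilt pi ti]]; exists (Ordinal ilt).
have Xp j : 0 < X i j w by have := pi j; rewrite sampleE mxE.
exists [ffun k => inord (minn b (nat_below (X i (lift ord0 k) w)))].
apply/exceedP => j /=; rewrite /y; case: unliftP => [k|] ->.
  rewrite ffunE inordK ?ltnS ?geq_minl//.
  have /andP[+ _] := nat_belowP _ (Xp (lift ord0 k)); apply: le_lt_trans.
  by rewrite ler_nat geq_minr.
rewrite gt_max Xp/= ltrBlDr.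
under eq_bigr do rewrite ffunE inordK ?ltnS ?geq_minl//.
(* If some coordinate reaches the cap [b >= M], the rounded values alone sum to at least [M], and
   positivity of the first coordinate suffices. Otherwise each of the [d'] roundings loses at most
   1, in all at most [d' = t - M]. *)
have [/existsP[k hk]|/existsPn hb] :=
  boolP [exists k, (b <= nat_below (X i (lift ord0 k) w))%N].
  rewrite (bigD1 k)//= (minn_idPl hk).
  apply: le_lt_trans tb _; rewrite addrCA ltrDl; apply: ltr_pwDl => //.
  exact: sumr_ge0.
rewrite ltrBlDr; apply: lt_le_trans ti _.
rewrite /coord_sum big_ord_recl sampleE -addrA lerD2l.
rewrite [d' in d'%:R](_ : _ = \sum_(k < d') 1)%N; last by rewrite sum1_card card_ord.
rewrite natr_sum -big_split/=; apply: ler_sum => k _; rewrite sampleE.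
have /minn_idPr -> : (nat_below (X i (lift ord0 k) w) <= b)%N.
  by rewrite ltnW// ltnNge hb.
by have /andP[] := nat_belowP _ (Xp (lift ord0 k)).
Qed.

(* A coordinate sum above [t i] contains [q ^ d'] disjoint boxes of equal probability:
   unit cells in all coordinates but the first, which takes up the rest of [t i]. *)
Lemma prob_no_large_sum (s : seq nat) (t : nat -> R) (q : nat) : uniq s ->
  (forall i, i \in s -> (q * d')%:R <= t i) ->
  prob_le P [set w | forall i, i \in s ->
      ~ (strictly_below 0 (sample X w i) /\ t i < coord_sum (sample X w i))]
    (expR (- \sum_(i <- s) ((q%:R * (1 - expR (-1))) ^+ d' * expR (- t i)))).
Proof.
move=> us ht; pose V := {ffun 'I_d' -> 'I_q}.
pose B (i : nat) (v : V) (j : 'I_d) : set R := if unlift ord0 j is Some k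
  then `](v k)%:R, (v k)%:R + 1]%classic else `]t i - \sum_k (v k)%:R, +oo[%classic.
(* Keeps the threshold of the first coordinate in the range of the exponential tail formula. *)
have tv i (v : V) : i \in s -> 0 <= t i - \sum_k (v k)%:R.
  move=> si; rewrite subr_ge0; apply: le_trans (ht i si).
  rewrite -natr_sum ler_nat; apply: (@leq_trans (\sum_(k < d') q)%N).
    by apply: leq_sum => k _; exact: ltnW.
  by rewrite sum_nat_const card_ord mulnC.
apply: prob_leS (prob_le_avoid_boxes indepX V B s
  (fun i => (q%:R * (1 - expR (-1))) ^+ d' * expR (- t i)) _ _ _ us).
- move=> w /= h i si v bw; apply: (h i si).
  have h0 : t i - \sum_k (v k)%:R < X i ord0 w.
    by have := bw ord0; rewrite /B unlift_none/= in_itv/= andbT.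
  have hk k : (v k)%:R < X i (lift ord0 k) w.
    by have := bw (lift ord0 k); rewrite /B liftK/= in_itv/= => /andP[].
  split.
    move=> j; rewrite sampleE mxE; case: (unliftP ord0 j) => [k|] ->.
      exact: le_lt_trans (hk k).
    by apply: le_lt_trans h0; exact: tv.
  rewrite /coord_sum big_ord_recl sampleE -ltrBlDr; apply: le_lt_trans h0.
  rewrite lerD2l lerN2; apply: ler_sum => k _; rewrite sampleE; exact/ltW/hk.
- by move=> i v j; rewrite /B; case: unlift => [k|].
- move=> i v v' w vv' h h'.
  have [k vk] : exists k, v k != v' k.
    apply/existsP; apply: contra_neqT vv' => /existsPn e.
    by apply/ffunP => k; apply/eqP; rewrite -[_ == _]negbK e.
  have := h (lift ord0 k); have := h' (lift ord0 k).
  rewrite /B !liftK/= !in_itv/= => /andP[a1 a2] /andP[b1 b2].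
  have := lt_le_trans a1 b2; have := lt_le_trans b1 a2.
  rewrite !natr1 !ltr_nat !ltnS => c1 c2.
  by move: vk; rewrite -val_eqE/= eqn_leq c1 c2.
(* The exponents of the unit cells cancel against that of the first coordinate, leaving
   [(1 - e^(-1))^d' e^(- t i)] for every [v]. *)
- move=> i si; rewrite (eq_bigr (fun=> (1 - expR (-1)) ^+ d' * expR (- t i))); last first.
    move=> v _; rewrite (pr_box indepX); last by move=> j; rewrite /B; case: unlift => [k|].
    rewrite big_ord_recl /B unlift_none (pr_X_gt expX); last exact: tv.
    rewrite [X in _ * X](eq_bigr (fun k => expR (- (v k)%:R) * (1 - expR (-1)))); last first.
      by move=> k _; rewrite liftK (pr_X_cell expX).
    rewrite big_split/= prodr_const card_ord -expR_sum sumrN opprB mulrA -expRD.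
    by rewrite addrAC subrr add0r mulrC.
  by rewrite sumr_const card_ffun !card_ord -[leRHS]mulr_natl natrX exprMn mulrA.
Qed.

End frontier_bounds.

(** * Measurability of the width *)

Section width_measurable.
Context {R : realType} {d' : nat} {dT : measure_display} {T : measurableType dT}
  {P : probability T R}.
Local Notation d := d'.+1.
Context {X : nat -> 'I_d -> {RV P >-> R}}.

(** Through [Fplus_gtP] the preimage of []x, +oo[] is a finite union of events on single
    observations, although [Fplus] is a supremum over an uncountable random set. *)
Lemma measurable_Fplus n :
  measurable_fun [set: T] (fun w => Fplus (sample X w) n).
Proof.
move=> mT; apply: (measurability _ (measurable_realfun.RGenOInfty.measurableE R)) => //.
move=> _ [_ [x ->] <-]; rewrite setTI.
have [x0|x0] := leP 0 x; last first.
  rewrite (_ : _ @^-1` _ = setT)//; apply/seteqP; split=> w //= _.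
  by rewrite in_itv/= andbT; apply: lt_le_trans x0 _; exact: Fplus_ge0.
rewrite (_ : _ @^-1` _ = [set w | exists2 i, i \in iota 0 n &
  (exceed (X := X) i (fun=> 0) `&` [set w | x < \sum_j X i j w]) w]).
  apply: measurable_exists_seq => i _; apply: measurableI.
    exact: measurable_exceed.
  rewrite -[X in measurable X]setTI -[X in setT `&` X](_ :
      (fun w => \sum_j X i j w) @^-1` `]x, +oo[ = _); last first.
    by apply/seteqP; split=> w /=; rewrite in_itv/= andbT.
  have ms : measurable_fun setT (fun w => \sum_j X i j w).
    by apply: measurable_sum => j; exact: measurable_funP.
  exact: ms.
apply/seteqP; split=> w /=; rewrite in_itv/= andbT.
  move=> /Fplus_gtP-/(_ isT x0)[i [ilt pi xi]]; exists i; first by rewrite mem_iota.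
  split; first by apply/exceedP => j; have := pi j; rewrite sampleE mxE.
  by move: xi; rewrite /coord_sum /=; under eq_bigr do rewrite sampleE.
move=> [i]; rewrite mem_iota/= add0n => ilt [/exceedP pi xi].
apply/Fplus_gtP => //; exists i; split=> //.
  by move=> j; rewrite sampleE mxE.
by rewrite /coord_sum; under eq_bigr do rewrite sampleE.
Qed.

(** Closed half-lines are used here because [Fminus_grid_geP] describes [x <= Fminus], as the
    complement of a countable union over grid points. *)
Lemma measurable_Fminus n :
  measurable_fun [set: T] (fun w => Fminus (sample X w) n).
Proof.
move=> mT; apply: (measurability _ (measurable_realfun.RGenCInfty.measurableE R)) => //.
move=> _ [_ [x ->] <-]; rewrite setTI.
have [x0|x0] := leP x 0.
  rewrite (_ : _ @^-1` _ = setT)//; apply/seteqP; split=> w //= _.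
  by rewrite in_itv/= andbT; apply: le_trans x0 _; exact: Fminus_ge0.
pose B (p : nat * {ffun 'I_d -> nat}) := [set w | \sum_j (p.2 j)%:R / p.1.+1%:R < x /\
  forall i, i \in iota 0 n ->
    (~` exceed (X := X) i (fun j => (p.2 j)%:R / p.1.+1%:R)) w].
rewrite (_ : _ @^-1` _ = ~` \bigcup_p B p).
  apply: measurableC; apply: countable_bigcupT_measurable; first exact: countableP.
  move=> p; rewrite /B; have [ps|ps] := ltP (\sum_j (p.2 j)%:R / p.1.+1%:R) x.
    rewrite (_ : mkset _ = [set w | forall i, i \in iota 0 n ->
      (~` exceed (X := X) i (fun j => (p.2 j)%:R / p.1.+1%:R)) w]).
      by apply: measurable_forall_seq => i _; apply: measurableC; exact: measurable_exceed.
    by apply/seteqP; split=> w //= -[].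
  rewrite (_ : mkset _ = set0)//; apply/seteqP; split=> w //= -[].
  by [].
apply/seteqP; split=> w /=; rewrite in_itv/= andbT.
  move=> /Fminus_grid_geP-/(_ isT x0) h [[k y] _ [/= yx ny]].
  have [i ilt yi] := h k y yx; apply: (ny i); first by rewrite mem_iota.
  by apply/exceedP => j; rewrite -sampleE.
move=> h; apply/Fminus_grid_geP => // k y yx; apply: contrapT => ny.
apply: h; exists (k, y) => //; split=> // i; rewrite mem_iota/= add0n => ilt /exceedP yi.
by apply: ny; exists i => // j; rewrite sampleE.
Qed.

Lemma measurable_width n : measurable_fun [set: T] (width X n).
Proof.
by apply: measurable_funB; [exact: measurable_Fplus|exact: measurable_Fminus].
Qed.

(** Convergence in probability evaluates [P] on this very event, whereas the estimates only bound
    outer probabilities; [prob_leP] needs measurability to pass from one to the other. *)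
Lemma measurable_width_deviation n (l a e : R) :
  measurable [set w | e < `| width X n w / l - a |].
Proof.
rewrite -[X in measurable X]setTI -[X in setT `&` X](_ :
  (fun w => `| width X n w / l - a |) @^-1` `]e, +oo[ = _); last first.
  by apply/seteqP; split=> w /=; rewrite in_itv/= andbT.
have mf : measurable_fun setT (fun w => `| width X n w / l - a |).
  apply: measurableT_comp => //; apply: measurable_funB => //.
  by apply: measurable_funM => //; exact: measurable_width.
exact: mf.
Qed.

End width_measurable.

(** * Comparisons between powers and logarithms *)

Section log_asymptotics.
Context {R : realType}.
Implicit Types (a b c e : R).

Lemma near_ln_ge a : \forall k \near \oo, a <= ln (k%:R : R).
Proof.
near=> k; rewrite -(expRK a) ler_ln ?posrE ?expR_gt0//; last first.
  rewrite (lt_le_trans (expR_gt0 a))//.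
  by near: k; exact: nbhs_infty_ger.
by near: k; exact: nbhs_infty_ger.
Unshelve. all: by end_near. Qed.

Lemma expR_ln_nat (k : nat) : (0 < k)%N -> expR (ln (k%:R : R)) = k%:R.
Proof. by move=> k0; rewrite lnK// posrE ltr0n. Qed.

(** With [x = e ln k], the term [x^2 / 2] of [exp x] beats any affine function of [ln k]. Most
    inequalities for large [k] below are instances. *)
Lemma near_affine_le_expR a b c e : 0 < c -> 0 < e ->
  \forall k \near \oo, a + b * ln (k%:R : R) <= c * expR (e * ln k%:R).
Proof.
move=> c0 e0.
(* Chosen so that [(|a| + |b| / e) x = (c C / 2) x], which is at most [c x^2 / 2] once [x >= C]. *)
pose C := (`|a| + `|b| / e) * 2 / c.
near=> k.
have : (1 + C) / e <= ln (k%:R : R) by near: k; exact: near_ln_ge.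
set l := ln _ => hl.
have C0 : 0 <= C by rewrite !mulr_ge0 ?invr_ge0 ?(ltW c0)// addr_ge0// mulr_ge0// invr_ge0 ltW.
pose x := e * l.
have lx : l = x / e by rewrite /x mulrC mulKf// gt_eqF.
have hx : 1 + C <= x by rewrite /x mulrC -ler_pdivrMr.
have x0 : 0 <= x by lra.
have h : 1 + x ^+ 2 / 2 <= expR x := expR_ge1Dxn 1 x0.
rewrite -/x; apply: le_trans (_ : c * (x ^+ 2 / 2) <= _); last first.
  by rewrite ler_pM2l//; lra.
apply: le_trans (_ : (`|a| + `|b| / e) * x <= _).
  rewrite mulrDl lx mulrA; apply: lerD.
    apply: le_trans (ler_norm a) _; rewrite ler_peMr//; lra.
  rewrite [leRHS]mulrAC ler_wpM2r ?invr_ge0 ?(ltW e0)//.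
  by rewrite ler_wpM2r// ler_norm.
have -> : (`|a| + `|b| / e) = C * c / 2.
  by rewrite /C divfK ?gt_eqF// mulfK.
have -> : c * (x ^+ 2 / 2) = (x * c / 2) * x by rewrite expr2; ring.
rewrite ler_wpM2r// ler_wpM2r// ler_wpM2r ?(ltW c0)//; lra.
Unshelve. all: by end_near. Qed.

(* [k^(-1-e)] is dominated by the increments of [-k^(-e)/e]. *)
Lemma expR_ln_telescope e (k : nat) : 0 < e -> (0 < k)%N ->
  e * expR (- ((1 + e) * ln (k.+1%:R : R))) <=
  expR (- (e * ln k%:R)) - expR (- (e * ln k.+1%:R)).
Proof.
move=> e0 k0; set g := expR (- (e * ln k.+1%:R)).
have k10 : 0 < k.+1%:R :> R by [].
have -> : expR (- ((1 + e) * ln (k.+1%:R : R))) = g / k.+1%:R.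
  by rewrite mulrDl mul1r opprD expRD expRN expR_ln_nat// mulrC.
have hln : ln (k%:R : R) <= ln k.+1%:R - k.+1%:R^-1.
  have -> : k%:R = k.+1%:R * (1 + - k.+1%:R^-1) :> R.
    by rewrite mulrDr mulrN divff// mulr1 -natr1 addrK.
  have p1 : 0 < 1 + - k.+1%:R^-1 :> R.
    by rewrite subr_gt0 invf_lt1// ltr1n ltnS.
  rewrite lnM ?posrE// lerD2l; apply: le_ln1Dx.
  by rewrite -subr_gt0 opprK addrC.
have : g * expR (e / k.+1%:R) <= expR (- (e * ln k%:R)).
  rewrite -expRD ler_expR -mulrN -mulrN -mulrDr ler_pM2l//.
  by rewrite -lerN2 opprD !opprK.
have := expR_ge1Dx (e / k.+1%:R).
have g0 : 0 < g by exact: expR_gt0.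
move=> h1 h2; have : g * (1 + e / k.+1%:R) <= expR (- (e * ln k%:R)).
  by apply: le_trans h2; rewrite ler_pM2l.
have -> : e * (g / k.+1%:R) = g * (e / k.+1%:R) by ring.
by rewrite mulrDr mulr1 -lerBrDl.
Qed.

Lemma ln2_le1 : ln 2 <= 1 :> R.
Proof. by rewrite (_ : 2 = 1 + 1)//; apply: le_ln1Dx; lra. Qed.

Lemma ln2_ge_half : 2^-1 <= ln 2 :> R.
Proof.
have : ln (1 + - 2^-1 : R) <= - 2^-1 by apply: le_ln1Dx; lra.
rewrite (_ : 1 + - 2^-1 = 2^-1); last by field.
by rewrite lnV ?posrE// lerN2.
Qed.

Lemma pow2E (k : nat) : (2 ^ k)%:R = expR (k%:R * ln 2) :> R.
Proof. by rewrite natrX expRM_natl lnK// posrE. Qed.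

End log_asymptotics.

(** * First Borel-Cantelli lemma for polynomial bounds *)

Section borel_cantelli.
Context {R : realType} {dT : measure_display} {T : measurableType dT}.
Variable P : probability T R.

Lemma borel_cantelli_power (A : nat -> set T) (C e : R) : 0 < e ->
  (\forall k \near \oo, prob_le P (A k) (C * expR (- ((1 + e) * ln k%:R)))) ->
  {ae P, forall w, \forall k \near \oo, ~ A k w}.
Proof.
move=> e0 [N _ hN].
(* The shift by two lets the telescoping inequality, stated for positive indices, start at
   [ln 1 = 0]; the finitely many early indices get the empty cover. *)
have hk k : exists B, [/\ measurable B, (N <= k)%N -> A k.+2 `<=` B &
    (P B <= (`|C| * expR (- ((1 + e) * ln k.+2%:R)))%:E)%E].
  have [Nk|kN] := leqP N k; last first.
    by exists set0; split=> //; rewrite measure0 lee_fin mulr_ge0// expR_ge0.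
  have [B [mB AB PB]] := hN k.+2 (leq_trans Nk (leq_trans (leqnSn _) (leqnSn _))).
  exists B; split=> //.
  by apply: le_trans PB _; rewrite lee_fin ler_wpM2r ?expR_ge0// ler_norm.
have [F hF] := choice hk.
have mF k : measurable (F k) by have [] := hF k.
(* Telescoping keeps all partial sums below [|C| / e]. *)
have sumF n : (\sum_(0 <= k < n) P (F k) <=
    (`|C| / e * (1 - expR (- (e * ln n.+1%:R))))%:E)%E.
  elim: n => [|n IH].
    by rewrite big_nil lee_fin ln1 mulr0 oppr0 expR0 subrr mulr0.
  have [_ _ PF] := hF n.
  rewrite big_nat_recr//=; apply: le_trans (leeD IH PF) _.
  rewrite -EFinD lee_fin.
  have := expR_ln_telescope e n.+1 e0 isT.
  rewrite -(ler_pM2l (_ : 0 < e^-1)) ?invr_gt0// mulKf ?gt_eqF// => h.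
  have := ler_wpM2l (normr_ge0 C) h.
  set g1 := expR (- (e * ln n.+1%:R)); set g2 := expR (- (e * ln n.+2%:R)).
  set x := _ * expR _; rewrite mulrA; nra.
have null : P (lim_sup_set F) = 0%E.
  apply: lim_sup_set_cvg0 => //.
  apply: (@le_lt_trans _ _ (`|C| / e)%:E); last exact: ltry.
  apply: lime_le.
    by apply: is_cvg_nneseries => n _ _; exact: measure_ge0.
  apply: nearW => n; apply: le_trans (sumF n) _; rewrite lee_fin.
  apply: ler_piMr; first by rewrite divr_ge0// ltW.
  by rewrite lerBlDr lerDl expR_ge0.
exists (lim_sup_set F); split=> //.
  apply: bigcapT_measurable => n; exact: bigcup_measurable.
move=> w /= nw n _; apply: contrapT => hn; apply: nw.
exists (maxn N n).+2 => // -[//|[//|k]] /=; rewrite !ltnS geq_max => /andP[Nk nk] Aw.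
apply: hn; exists k => //; have [_ AF _] := hF k.
exact: AF Nk _ Aw.
Qed.


End borel_cantelli.

(** * Estimates at powers of two *)

Section dyadic_bounds.
Context {R : realType} {d' : nat} {dT : measure_display} {T : measurableType dT}
  {P : probability T R}.
Local Notation d := d'.+1.
Context {X : nat -> 'I_d -> {RV P >-> R}}.
Hypothesis indepX : mutually_independent (fun ij : nat * 'I_d => X ij.1 ij.2).
Hypothesis expX : forall (i : nat) (j : 'I_d) (A : set R), measurable A ->
  distribution P (X i j) A = exponential_prob (1 : R) A.

(** Here [n e^(-(c + d))] equals [e^(-d) k^e], whose exponential beats the number of grid points, at
    most [(3 k)^d], with a factor [k^2] to spare. *)
Lemma prob_Fminus_lt_dyadic (e : R) : 0 < e ->
  \forall k \near \oo, prob_le P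
    [set w | Fminus (sample X w) (2 ^ k) < k%:R * ln 2 - e * ln k%:R]
    (expR (- (2 * ln k%:R))).
Proof.
move=> e0.
(* [aff1] makes the level [c] positive; [aff2] makes [e^(-d) k^e] exceed the logarithm of
   [3^d k^(d+2)]. *)
have aff1 := near_affine_le_expR 1 e 2^-1 1 (ltac:(by rewrite invr_gt0)) ltr01.
have aff2 := near_affine_le_expR (ln (3 ^+ d)) (d%:R + 2) (expR (- d%:R)) e
  (expR_gt0 _) e0.
near=> k.
have k0 : (0 < k)%N by near: k; exact: nbhs_infty_gt.
have h1 : 1 + e * ln k%:R <= 2^-1 * expR (1 * ln k%:R :> R) by near: k; exact: aff1.
have h2 : ln (3 ^+ d) + (d%:R + 2) * ln k%:R <= expR (- d%:R) * expR (e * ln k%:R :> R).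
  by near: k; exact: aff2.
have l0 : 0 <= ln (k%:R : R) by rewrite ln_ge0// ler1n.
rewrite mul1r expR_ln_nat// in h1.
have kp : 0 < k%:R :> R by rewrite ltr0n.
have ka := ler_wpM2l (ltW kp) ln2_ge_half; have ka' := ler_wpM2l (ltW kp) ln2_le1.
rewrite mulr1 in ka'.
set c := k%:R * ln 2 - e * ln k%:R.
have el : 0 <= e * ln (k%:R : R) by rewrite mulr_ge0// ltW.
have c0 : 0 < c by rewrite /c; lra.
apply: prob_leW (prob_Fminus_lt indepX expX _ _ c0).
have -> : (2 ^ k)%:R * expR (- (c + d%:R)) = expR (- d%:R) * expR (e * ln k%:R :> R).
  by rewrite pow2E -!expRD /c; congr expR; ring.
apply: le_trans (_ : (3 * k%:R) ^+ d * expR (- (ln (3 ^+ d) + (d%:R + 2) * ln k%:R)) <= _).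
  apply: ler_pM; [exact: exprn_ge0|exact: expR_ge0| |by rewrite ler_expR lerN2].
  rewrite lerXn2r ?nnegrE ?mulr_ge0//.
  have : (Num.truncn c)%:R <= c by rewrite truncn_le ltW.
  have : 1 <= k%:R :> R by rewrite ler1n.
  rewrite -addn2 natrD /c; lra.
have e3 : expR (- ln (3 ^+ d)) = (3 ^+ d)^-1 :> R by rewrite expRN lnK// posrE exprn_gt0.
rewrite exprMn opprD expRD e3 mulrACA divff ?expf_neq0// mul1r.
rewrite -{1}(expR_ln_nat k)// -expRM_natl -expRD ler_expR.
by rewrite le_eqVlt; apply/orP; left; apply/eqP; ring.
Unshelve. all: by end_near. Qed.

(** One test point on the first axis, of sum [c' < c], must be dominated, which has probability of
    order [2^k e^(-c') = k^(-e/2)]. This need not be summable, but it tends to 0 in every dimension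
    and suffices for convergence in probability. *)
Lemma prob_Fminus_ge_dyadic1 (e : R) : 0 < e ->
  \forall k \near \oo, prob_le P
    [set w | k%:R * ln 2 + e * ln k%:R <= Fminus (sample X w) (2 ^ k)]
    (2 * expR (- (e / 2 * ln k%:R))).
Proof.
move=> e0; near=> k.
have k0 : (0 < k)%N by near: k; exact: nbhs_infty_gt.
have l1 : 1 <= ln (k%:R : R) by near: k; exact: near_ln_ge.
have el : 0 < e * ln (k%:R : R) by rewrite mulr_gt0//; lra.
have a2 := @ln2_ge_half R.
have kp : 0 < k%:R :> R by rewrite ltr0n.
have ka : 0 <= k%:R * ln 2 :> R by rewrite mulr_ge0//; lra.
set c := k%:R * ln 2 + e * ln k%:R.
set c' := k%:R * ln 2 + e / 2 * ln k%:R.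
have cc' : c' < c by rewrite /c /c'; lra.
have c'0 : 0 <= c' by rewrite /c'; lra.
pose x (_ : 'I_1) (j : 'I_d) : R := if j == ord0 then c' else 0.
have sx b : \sum_j x b j = c'.
  by rewrite (bigD1 ord0)//= /x eqxx big1 ?addr0// => j /negbTE ->.
have x0 b j : 0 <= x b j by rewrite /x; case: ifP.
(* With one point there are no pairs, so the condition on the join is vacuous; the choice [M = c]
   makes the second term no larger than the first. *)
apply: prob_leS (prob_leW _ _ _ _ _ (prob_all_dominated indepX expX (2 ^ k) 1 x c x0 _)).
- move=> w /= cF i.
  have /dominated_sample : dominated (sample X w) (2 ^ k) (\row_j x i j).
    have c0 : 0 < c by lra.
    apply: (proj1 (Fminus_geP (sample X w) (2 ^ k) c isT c0) cF).
    + by move=> j; rewrite mxE.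
    + by rewrite /coord_sum; under eq_bigr do rewrite mxE; rewrite sx.
  move=> [i0 lt0 /exceedP h0]; exists i0 => //; apply/exceedP => j.
  by have := h0 j; rewrite mxE.
- rewrite big_ord1 sx expr1 pow2E muln1 mul1n pow2E -!expRD.
  rewrite (_ : _ - c' = - (e / 2 * ln k%:R)); last by rewrite /c'; ring.
  rewrite [leRHS](_ : _ =
    expR (- (e / 2 * ln k%:R)) + expR (- (e / 2 * ln k%:R))); last by ring.
  rewrite lerD2l ler_expR /c; lra.
- by move=> i j; rewrite !ord1 eqxx.
Unshelve. all: by end_near. Qed.

(** At this level [2^k e^(-t) = k^(-s)], while the grid has at most [(3 k)^d'] points, whence the
    exponent [d' - s]. *)
Lemma prob_Fplus_gt_dyadic (s : R) : 0 <= s ->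
  \forall k \near \oo, prob_le P
    [set w | k%:R * ln 2 + s * ln k%:R < Fplus (sample X w) (2 ^ k)]
    (3 ^+ d' * expR d'%:R * expR (- ((s - d'%:R) * ln k%:R))).
Proof.
move=> s0.
have aff := near_affine_le_expR 0 s 1 1 ltr01 ltr01.
near=> k.
have k0 : (0 < k)%N by near: k; exact: nbhs_infty_gt.
have : 0 + s * ln k%:R <= 1 * expR (1 * ln k%:R :> R) by near: k; exact: aff.
rewrite add0r !mul1r expR_ln_nat// => h.
have kp : 0 < k%:R :> R by rewrite ltr0n.
have ka := ler_wpM2l (ltW kp) ln2_ge_half; have ka' := ler_wpM2l (ltW kp) ln2_le1.
have l0 : 0 <= s * ln (k%:R : R) by rewrite mulr_ge0// ln_ge0// ler1n.
(* The cap [2 k] is large enough: [k ln 2 <= k], and [s ln k <= k] for large [k]. *)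
apply: prob_leW (prob_Fplus_gt indepX expX _ _ (2 * k)%N _ _).
- rewrite pow2E.
  apply: le_trans (_ : expR (k%:R * ln 2) * ((3 * k%:R) ^+ d' *
     expR (- (k%:R * ln 2 + s * ln k%:R - d'%:R))) <= _).
    rewrite ler_pM2l ?expR_gt0// ler_pM2r ?expR_gt0// lerXn2r ?nnegrE ?mulr_ge0//.
    by rewrite -natrM ler_nat; lia.
  rewrite exprMn -{2}(expR_ln_nat k)// -expRM_natl -!mulrA mulrCA ler_pM2l ?exprn_gt0//.
  rewrite -!expRD ler_expR.
  by rewrite le_eqVlt; apply/orP; left; apply/eqP; ring.
- lra.
- have : 0 <= d'%:R :> R by [].
  rewrite natrM; lra.
Unshelve. all: by end_near. Qed.

(* The test points are spread along the segment joining two axes of the simplex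
   [x_+ = c']; the join of two of them has a coordinate sum larger by [c' / m']. *)
Lemma prob_Fminus_ge_dyadic (e : R) : (0 < d')%N -> 0 < e ->
  \forall k \near \oo, prob_le P
    [set w | k%:R * ln 2 + e * ln k%:R <= Fminus (sample X w) (2 ^ k)]
    (2 * expR (- (2 * ln k%:R))).
Proof.
move=> dd e0.
have join_gap (p q r : nat) : (p < q)%N -> (q < r.+1)%N -> (r < q + (r - p))%N by lia.
(* There are [m' + 1] test points, each contributing a factor [k^(-e/2)]; this choice makes their
   product at most [k^(-2)]. *)
pose m' := (Num.truncn (4 / e)).+1.
have hm : 2 <= m'.+1%:R * (e / 2).
  have h4 : 4 / e < m'%:R by exact: truncnS_gt.
  rewrite ltr_pdivrMr// in h4.
  have : m'%:R <= m'.+1%:R :> R by rewrite ler_nat.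
  by move=> h5; have := ler_wpM2r (ltW e0) h5; lra.
have m'0 : 0 < m'%:R :> R by rewrite ltr0n.
have a2 := @ln2_ge_half R.
have a3 : 0 < ln 2 / m'%:R :> R by rewrite divr_gt0//; lra.
have aff := near_affine_le_expR (ln (m'.+1 * m'.+1)%:R) 2 _ 1 a3 ltr01.
pose j1 : 'I_d := lift ord0 (Ordinal dd).
have j10 : j1 != ord0 by [].
near=> k.
have k0 : (0 < k)%N by near: k; exact: nbhs_infty_gt.
have : ln (m'.+1 * m'.+1)%:R + 2 * ln k%:R <= ln 2 / m'%:R * expR (1 * ln k%:R :> R).
  by near: k; exact: aff.
rewrite mul1r expR_ln_nat// => h2.
have l1 : 1 <= ln (k%:R : R) by near: k; exact: near_ln_ge.
have el : 0 < e * ln (k%:R : R) by rewrite mulr_gt0//; lra.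
have kp : 0 < k%:R :> R by rewrite ltr0n.
have ka : 0 <= k%:R * ln 2 :> R by rewrite mulr_ge0//; lra.
set c := k%:R * ln 2 + e * ln k%:R.
set c' := k%:R * ln 2 + e / 2 * ln k%:R.
have cc' : c' < c by rewrite /c /c'; lra.
have c'0 : 0 <= c' by rewrite /c'; lra.
(* Spacing of the test points and least gain of a join; it grows linearly in [k]. *)
pose r := c' / m'%:R.
have r0 : 0 <= r by rewrite divr_ge0// ltW.
have rc' : m'%:R * r = c' by rewrite mulrC divfK// gt_eqF.
pose x (b : 'I_m'.+1) (j : 'I_d) : R := if j == ord0 then b%:R * r else
  if j == j1 then (m' - b)%:R * r else 0.
have sum2 (f : 'I_d -> R) : (forall j, j != ord0 -> j != j1 -> f j = 0) ->
    \sum_j f j = f ord0 + f j1.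
  move=> h; rewrite (bigD1 ord0)//= (bigD1 j1)//= big1 ?addr0//.
  by move=> j /andP[]; exact: h.
have x_0 b : x b ord0 = b%:R * r by rewrite /x eqxx.
have x_1 b : x b j1 = (m' - b)%:R * r by rewrite /x (negbTE j10) eqxx.
have x_2 b j : j != ord0 -> j != j1 -> x b j = 0 by rewrite /x => /negbTE -> /negbTE ->.
have sx b : \sum_j x b j = c'.
  rewrite sum2; last exact: x_2.
  rewrite x_0 x_1 -mulrDl -natrD subnKC// -ltnS; exact: ltn_ord.
have x0 b j : 0 <= x b j by rewrite /x; case: ifP => _; [|case: ifP => // _]; rewrite mulr_ge0.
apply: prob_leS (prob_leW _ _ _ _ _
  (prob_all_dominated indepX expX (2 ^ k) m'.+1 x (c' + r) x0 _)).
- move=> w /= cF i.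
  have /dominated_sample : dominated (sample X w) (2 ^ k) (\row_j x i j).
    have c0 : 0 < c by lra.
    apply: (proj1 (Fminus_geP (sample X w) (2 ^ k) c isT c0) cF).
    + by move=> j; rewrite mxE.
    + by rewrite /coord_sum; under eq_bigr do rewrite mxE; rewrite sx.
  move=> [i0 lt0 /exceedP h0]; exists i0 => //; apply/exceedP => j.
  by have := h0 j; rewrite mxE.
- rewrite [leRHS](_ : _ = expR (- (2 * ln k%:R)) + expR (- (2 * ln k%:R))); last by ring.
  (* Distinct dominators give [k^(-(m' + 1) e / 2)]. A common dominator gives a constant times
     [k^(-e/2) e^(-r)], exponentially small in [k]. *)
  apply: lerD.
    rewrite (eq_bigr (fun=> c')); last by move=> b _; exact: sx.
    rewrite sumr_const card_ord pow2E -expRM_natl -expRD ler_expR -[c' *+ _]mulr_natl.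
    rewrite -mulrBr (_ : _ - c' = - (e / 2 * ln k%:R)); last by rewrite /c'; ring.
    rewrite mulrN lerN2 mulrA ler_wpM2r//; lra.
  rewrite natrM pow2E -mulrA -expRD.
  apply: le_trans (_ : (m'.+1 * m'.+1)%:R * expR (- (ln 2 / m'%:R * k%:R)) <= _).
    rewrite ler_wpM2l// ler_expR.
    have : k%:R * ln 2 / m'%:R <= r.
      by rewrite ler_wpM2r ?invr_ge0 ?(ltW m'0)// /c'; lra.
    rewrite [k%:R * ln 2 / _](_ : _ = ln 2 / m'%:R * k%:R); last by ring.
    rewrite /c'; lra.
  rewrite -{1}(@lnK _ (m'.+1 * m'.+1)%:R) ?posrE ?ltr0n// -expRD ler_expR; lra.
- move=> b1 b2; wlog b12 : b1 b2 / (b1 < b2)%N.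
    move=> hw; case: (ltngtP b1 b2) => [bb|bb|/ord_inj ->]; [exact: hw| |by rewrite eqxx].
    rewrite eq_sym => ne; apply: le_trans (hw _ _ bb ne) _.
    by apply: ler_sum => j _; rewrite maxC.
  move=> _; rewrite sum2; last by move=> j j0 jj1; rewrite !x_2// maxxx.
  rewrite !x_0 !x_1; apply: le_trans (_ : b2%:R * r + (m' - b1)%:R * r <= _).
    rewrite -rc' -[X in _ + X]mul1r -!mulrDl ler_wpM2r// -natrD natr1 ler_nat.
    exact: (join_gap b1 b2 m' b12 (ltn_ord b2)).
  by apply: lerD; rewrite le_max lexx ?orbT.
Unshelve. all: by end_near. Qed.

Lemma scaled_power (k m : nat) (u : R) : (0 < k)%N ->
  (k%:R / u) ^+ m = u^-1 ^+ m * expR (m%:R * ln k%:R).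
Proof. by move=> k0; rewrite exprMn mulrC expRM_natl expR_ln_nat. Qed.

(** Rounding [k / (4 d)] down and the factor [1 - e^(-1) >= 1/2] each cost at most a factor 2 for
    large [k]. *)
Lemma near_cells : \forall k \near \oo,
  k%:R / (16 * d)%:R <= (k %/ (4 * d))%:R * (1 - expR (-1)) :> R.
Proof.
near=> k.
have kd : (8 * d <= k)%N by near: k; exact: nbhs_infty_ge.
have half : 2^-1 <= 1 - expR (-1) :> R.
  have := expR_ge1Dx (1 : R); rewrite expRN => h.
  have : (expR 1)^-1 <= 2^-1 :> R.
    by rewrite lef_pV2 ?posrE ?expR_gt0//; lra.
  lra.
apply: le_trans (_ : (k %/ (4 * d))%:R * 2^-1 <= _); last by rewrite ler_wpM2l.
rewrite ler_pdivrMr ?ltr0n ?muln_gt0//.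
have -> : (k %/ (4 * d))%:R * 2^-1 * (16 * d)%:R = (k %/ (4 * d) * (8 * d))%:R :> R.
  by rewrite !natrM; field.
rewrite ler_nat; have := divn_eq k (4 * d); have := @ltn_pmod k (4 * d) isT.
have : (2 <= k %/ (4 * d))%N by rewrite leq_divRL//; lia.
move: (k %/ (4 * d))%N (k %% (4 * d))%N => q r; nia.
Unshelve. all: by end_near. Qed.

(* On [s] the expected number of coordinate sums above the thresholds [t] is at
   least [(k / 16d)^d' * sum e^(-t)], provided that all thresholds exceed [k/4]. *)
Lemma near_prob_no_large_sum : \forall k \near \oo, forall (s : seq nat) (t : nat -> R),
  uniq s -> (forall i, i \in s -> k%:R / 4 <= t i) ->
  prob_le P [set w | forall i, i \in s ->
      ~ (strictly_below 0 (sample X w i) /\ t i < coord_sum (sample X w i))]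
    (expR (- ((k%:R / (16 * d)%:R) ^+ d' * \sum_(i <- s) expR (- t i)))).
Proof.
near=> k => s t us ht.
have hk : k%:R / (16 * d)%:R <= (k %/ (4 * d))%:R * (1 - expR (-1)) :> R.
  by near: k; exact: near_cells.
apply: prob_leW (prob_no_large_sum indepX expX s t (k %/ (4 * d)) us _).
  rewrite ler_expR lerN2 -mulr_sumr; apply: ler_wpM2r.
    by apply: sumr_ge0 => i _; exact: expR_ge0.
  have k0 : 0 <= k%:R / (16 * d)%:R :> R by rewrite divr_ge0.
  apply: lerXn2r => //; rewrite nnegrE//; exact: le_trans hk.
(* About [k / (4 d)] cells per axis keep [q d'] at most [k / 4], the assumed lower bound on the
   thresholds. *)
move=> i si; apply: le_trans (ht i si); rewrite ler_pdivlMr// -natrM ler_nat.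
have := leq_trunc_div k (4 * d); move: (k %/ (4 * d))%N => q; nia.
Unshelve. all: by end_near. Qed.

(** The expected number of exceedances is at least [(k / 16d)^d' 2^k e^(-t)], a constant times
    [k^e], so the probability of having none is at most [k^(-2)] for large [k]. *)
Lemma prob_Fplus_le_dyadic (e : R) : 0 < e ->
  \forall k \near \oo, prob_le P
    [set w | Fplus (sample X w) (2 ^ k) <= k%:R * ln 2 + (d'%:R - e) * ln k%:R]
    (expR (- (2 * ln k%:R))).
Proof.
move=> e0; have nls := near_prob_no_large_sum.
have c0 : 0 < ((16 * d)%:R^-1 : R) ^+ d' by rewrite exprn_gt0// invr_gt0 ltr0n.
have aff1 := near_affine_le_expR 0 2 _ e c0 e0.
have c1 : 0 < 4^-1 :> R by rewrite invr_gt0.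
have aff2 := near_affine_le_expR 0 e _ 1 c1 ltr01.
have a2 := @ln2_ge_half R.
near=> k.
have k0 : (0 < k)%N by near: k; exact: nbhs_infty_gt.
have kp : 0 < k%:R :> R by rewrite ltr0n.
have : 0 + 2 * ln k%:R <= ((16 * d)%:R^-1 : R) ^+ d' * expR (e * ln k%:R).
  by near: k; exact: aff1.
rewrite add0r => h1.
have : 0 + e * ln k%:R <= 4^-1 * expR (1 * ln k%:R :> R) by near: k; exact: aff2.
rewrite add0r mul1r expR_ln_nat// => h2.
have l0 : 0 <= ln (k%:R : R) by rewrite ln_ge0// ler1n.
have ka := ler_wpM2l (ltW kp) a2.
have dl : 0 <= d'%:R * ln (k%:R : R) by rewrite mulr_ge0.
set t := k%:R * ln 2 + _.
have tk : k%:R / 4 <= t by rewrite /t; lra.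
have t0 : 0 <= t by lra.
apply: prob_leS (prob_leW _ _ _ _ _ (_ : prob_le P [set w | forall i, i \in iota 0 (2 ^ k) ->
      ~ (strictly_below 0 (sample X w i) /\ t < coord_sum (sample X w i))]
    (expR (- ((k%:R / (16 * d)%:R) ^+ d' * \sum_(i <- iota 0 (2 ^ k)) expR (- t)))))).
- move=> w /= Ft i; rewrite mem_iota/= add0n => ilt [pi ti].
  have : t < Fplus (sample X w) (2 ^ k) by apply/Fplus_gtP => //; exists i.
  by rewrite ltNge Ft.
- rewrite ler_expR lerN2; apply: le_trans h1 _.
  rewrite big_const_seq count_predT size_iota iter_addr_0 -[expR (- t) *+ _]mulr_natl pow2E.
  rewrite scaled_power// -mulrA ler_pM2l// -!expRD ler_expR /t.
  by rewrite le_eqVlt; apply/orP; left; apply/eqP; ring.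
- by apply: (near nls k) => //; exact: iota_uniq.
Unshelve. all: by end_near. Qed.

(** The classical divergence argument for the harmonic series: each of the [r] dyadic scales
    contributes at least [1/2]. *)
Lemma sum_inv_dyadic (k r : nat) :
  r%:R / 2 <= \sum_(2 ^ k <= i < 2 ^ (k + r)) (i.+1%:R^-1 : R).
Proof.
elim: r => [|r IH]; first by rewrite mul0r sumr_ge0.
rewrite (@big_cat_nat _ _ _ (2 ^ (k + r)))/=; [|by rewrite leq_pexp2l//; lia..].
rewrite -natr1 mulrDl; apply: lerD => //.
rewrite addnS expnS mul2n -addnn.
apply: le_trans (_ : \sum_(2 ^ (k + r) <= i < 2 ^ (k + r) + 2 ^ (k + r))
    ((2 ^ (k + r)).*2%:R^-1 : R) <= _).
  rewrite sumr_const_nat addnK -[leRHS]mulr_natl -addnn natrD.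
  have : 0 < (2 ^ (k + r))%:R :> R by rewrite ltr0n expn_gt0.
  move: ((2 ^ (k + r))%:R : R) => u u0.
  rewrite (_ : u / (u + u) = 1 / 2)//; field.
  by rewrite gt_eqF//=; lra.
apply: ler_sum_nat => i /andP[_ ih].
by rewrite lef_pV2 ?posrE ?ltr0n// ?double_gt0 ?expn_gt0// ler_nat -addnn.
Qed.

(** Since [e^(-t)] is [1 / (i + 1)] times [ln (i + 1)^(-(d - e))], the harmonic sum over [k] scales
    supplies an extra factor [k], which lifts the critical coefficient from [d - 1] to [d]. The
    thresholds use [i + 1], the first time at which observation [i] counts. *)
Lemma prob_no_large_sum_dyadic (e : R) : 0 < e <= 1 ->
  \forall k \near \oo, prob_le P
    [set w | forall i, (2 ^ k <= i < 2 ^ (k + k))%N ->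
      ~ (strictly_below 0 (sample X w i) /\
         ln i.+1%:R + (d%:R - e) * ln (ln i.+1%:R) < coord_sum (sample X w i))]
    (expR (- (2 * ln k%:R))).
Proof.
move=> /andP[e0 e1]; have nls := near_prob_no_large_sum.
(* The factors come from the number of cells, from the harmonic sum, and from [ln (i + 1) <= 2 k] on
   the block. *)
pose c := ((16 * d)%:R^-1 : R) ^+ d' * (2^-1 * expR (- ((d%:R - e) * ln 2))).
have c0 : 0 < c.
  by rewrite !mulr_gt0 ?expR_gt0// exprn_gt0// invr_gt0 ltr0n.
have aff1 := near_affine_le_expR 0 2 _ e c0 e0.
have a2 := @ln2_ge_half R.
have a1 := @ln2_le1 R.
have de : 0 <= d%:R - e.
  by rewrite subr_ge0; apply: le_trans e1 _; rewrite ler1n.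
near=> k.
have k2 : (2 <= k)%N by near: k; exact: nbhs_infty_ge.
have k0 : (0 < k)%N by apply: leq_trans k2.
have kp : 0 < k%:R :> R by rewrite ltr0n.
have : 0 + 2 * ln k%:R <= c * expR (e * ln k%:R).
  by near: k; exact: aff1.
rewrite add0r => h1.
pose t (i : nat) : R := ln i.+1%:R + (d%:R - e) * ln (ln i.+1%:R).
have ti (i : nat) : (2 ^ k <= i < 2 ^ (k + k))%N ->
    k%:R / 2 <= ln (i.+1%:R : R) <= (k + k)%:R.
  move=> /andP[i1 i2]; apply/andP; split.
    apply: le_trans (_ : k%:R * ln 2 <= _); first by rewrite ler_pM2l.
    rewrite -[leLHS]expRK -pow2E ler_ln ?posrE ?ltr0n ?expn_gt0//.
    by rewrite ler_nat; apply: leq_trans i1 _.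
  apply: le_trans (_ : (k + k)%:R * ln 2 <= _); last by rewrite ler_piMr.
  by rewrite -[leRHS]expRK -pow2E ler_ln ?posrE ?ltr0n ?expn_gt0// ler_nat.
apply: prob_leS (prob_leW _ _ _ _ _
  ((near nls k _) (index_iota (2 ^ k) (2 ^ (k + k))) t _ _)) => //.
- by move=> w /= h i; rewrite mem_index_iota; exact: h.
- rewrite ler_expR lerN2; apply: le_trans h1 _.
  apply: le_trans (_ : (k%:R / (16 * d)%:R) ^+ d' *
    (expR (- ((d%:R - e) * ln (k + k)%:R)) * (k%:R / 2)) <= _).
    rewrite scaled_power// /c -!mulrA ler_pM2l ?exprn_gt0 ?invr_gt0 ?ltr0n//.
    rewrite addnn -mul2n natrM lnM ?posrE ?ltr0n//.
    rewrite -{4}(expR_ln_nat k)// !mulrA ![_ / 2]mulrC -!mulrA ler_pM2l ?invr_gt0//.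
    rewrite -!expRD ler_expR -natr1.
    by rewrite le_eqVlt; apply/orP; left; apply/eqP; ring.
  rewrite ler_wpM2l ?exprn_ge0 ?divr_ge0//.
  apply: le_trans (_ : expR (- ((d%:R - e) * ln (k + k)%:R)) *
     \sum_(2 ^ k <= i < 2 ^ (k + k)) (i.+1%:R^-1 : R) <= _).
    by rewrite ler_wpM2l ?expR_ge0// sum_inv_dyadic.
  rewrite mulr_sumr; apply: ler_sum_nat => i ih.
  rewrite /t opprD expRD [leRHS]mulrC [X in _ <= _ * X]expRN lnK ?posrE ?ltr0n//.
  rewrite ler_wpM2r ?invr_ge0// ler_expR lerN2 ler_wpM2l//.
  have /andP[t1 t2] := ti i ih.
  have : 0 < ln (i.+1%:R : R) by apply: lt_le_trans t1; rewrite divr_gt0.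
  by move=> p; rewrite ler_ln ?posrE// ltr0n addn_gt0 k0.
- exact: iota_uniq.
- move=> i; rewrite mem_index_iota => ih; have /andP[t1 _] := ti i ih.
  have k2' : 2 <= k%:R :> R by rewrite ler_nat.
  have : 0 <= (d%:R - e) * ln (ln (i.+1%:R : R)).
    by rewrite mulr_ge0// ln_ge0//; lra.
  rewrite /t; lra.
Unshelve. all: by end_near. Qed.

End dyadic_bounds.

(** * Vanishing outer probabilities and almost sure consequences *)

Section vanishing.
Context {R : realType} {dT : measure_display} {T : measurableType dT}.
Variable P : probability T R.
Implicit Types A E : nat -> set T.

Definition vanishing A :=
  forall e : R, 0 < e -> \forall n \near \oo, prob_le P (A n) e.

Definition ae_finally_not A := {ae P, forall w, \forall n \near \oo, ~ A n w}.

Lemma near_subseq (Q : nat -> Prop) (g : nat -> nat) :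
  (forall N, \forall n \near \oo, (N <= g n)%N) ->
  (\forall k \near \oo, Q k) -> \forall n \near \oo, Q (g n).
Proof. by move=> hg [N _ hN]; apply: filterS (hg N) => n; exact: hN. Qed.

Lemma vanishing_power A (C e : R) : 0 < e ->
  (\forall k \near \oo, prob_le P (A k) (C * expR (- (e * ln k%:R)))) -> vanishing A.
Proof.
move=> e0 hA r r0.
have aff := near_affine_le_expR `|C| 0 r e r0 e0.
near=> k.
have : `|C| + 0 * ln k%:R <= r * expR (e * ln k%:R) by near: k; exact: aff.
rewrite mul0r addr0 => h.
apply: prob_leW (near hA k _) => //.
rewrite expRN ler_pdivrMr ?expR_gt0//; apply: le_trans h; exact: ler_norm.
Unshelve. all: by end_near. Qed.

Lemma vanishing_subseq A E (g : nat -> nat) :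
  (forall N, \forall n \near \oo, (N <= g n)%N) ->
  (\forall n \near \oo, A n `<=` E (g n)) -> vanishing E -> vanishing A.
Proof.
move=> hg AE vE r r0; near=> n.
apply: (@prob_leS _ _ _ _ _ (E (g n))); first by near: n.
by near: n; apply: (near_subseq (fun k => prob_le P (E k) r) g hg); exact: vE.
Unshelve. all: by end_near. Qed.

Lemma ae_finally_not_subseq A E (g : nat -> nat) :
  (forall N, \forall n \near \oo, (N <= g n)%N) ->
  (\forall n \near \oo, A n `<=` E (g n)) -> ae_finally_not E -> ae_finally_not A.
Proof.
move=> hg AE; apply: filterS => w hw; near=> n => /(near AE n _) => AEn.
have : ~ E (g n) w.
  by near: n; exact: (near_subseq (fun k => ~ E k w) g hg hw).
by apply; apply: AEn.
Unshelve. all: by end_near. Qed.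

Lemma vanishing_setU A E : vanishing A -> vanishing E ->
  vanishing (fun n => A n `|` E n).
Proof.
move=> vA vE r r0; have r2 : 0 < r / 2 by rewrite divr_gt0.
near=> n; rewrite [r]splitr.
by apply: prob_leU; near: n; [exact: (vA _ r2)|exact: (vE _ r2)].
Unshelve. all: by end_near. Qed.

(** The intersection of measurable covers of probability at most [1 / (k + 1)] is a null cover. *)
Lemma prob_le_negligible (B : set T) :
  (forall e : R, 0 < e -> prob_le P B e) -> P.-negligible B.
Proof.
move=> hB.
have hk (k : nat) : exists C, [/\ measurable C, B `<=` C & (P C <= (k.+1%:R^-1)%:E)%E].
  by apply: hB; rewrite invr_gt0.
have [C hC] := choice hk.
have mC k : measurable (C k) by have [] := hC k.
have mI : measurable (\bigcap_k C k) by exact: bigcapT_measurable.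
exists (\bigcap_k C k); split=> //; last first.
  by move=> w Bw k _; have [_ BC _] := hC k; exact: BC.
apply/eqP; rewrite eq_le measure_ge0 andbT leNgt; apply/negP.
rewrite prE// lte_fin => p0.
pose k := Num.truncn (pr P (\bigcap_k C k))^-1.
have [_ _ Ck] := hC k.
have : pr P (\bigcap_k C k) <= k.+1%:R^-1.
  rewrite -lee_fin -prE//; apply: le_trans Ck.
  by apply: le_measure; rewrite ?inE//; exact: bigcap_inf.
apply/negP; rewrite -ltNge -[ltRHS]invrK ltf_pV2 ?posrE ?invr_gt0//.
exact: truncnS_gt.
Qed.

(** The event that all [A n] with [n >= N] occur lies in each of them, hence is negligible. This
    takes the place of the second Borel-Cantelli lemma and asks for no independence between the
    [A n]. *)
Lemma vanishing_io A : vanishing A ->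
  {ae P, forall w, forall N, exists2 n, (N <= n)%N & ~ A n w}.
Proof.
move=> vA; apply: ae_foralln => N.
apply: (@negligibleS _ _ _ _ (\bigcap_(n in [set n | (N <= n)%N]) A n)).
  by move=> w /= h n Nn; apply: contrapT => nA; apply: h; exists n.
apply: prob_le_negligible => r r0.
have [M _ hM] := vA r r0.
apply: prob_leS (hM (maxn N M) (leq_maxr _ _)) => w; apply.
exact: leq_maxl.
Qed.

End vanishing.

(** * Iterated logarithms between powers of two *)

Section loglog.
Context {R : realType}.

Lemma near_trunc_log N : \forall n \near \oo, (N <= trunc_log 2 n)%N.
Proof.
near=> n; rewrite -(@trunc_expnK 2 N)//; apply: leq_trunc_log.
by near: n; exact: nbhs_infty_ge.
Unshelve. all: by end_near. Qed.

Lemma near_trunc_logS N : \forall n \near \oo, (N <= (trunc_log 2 n).+1)%N.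
Proof. by apply: filterS (near_trunc_log N) => n /leq_trans; apply. Qed.

Lemma near_lnln_ge (a : R) : \forall n \near \oo, a <= ln (ln (n%:R : R)).
Proof.
near=> n; rewrite -(expRK a).
have : expR a <= ln (n%:R : R) by near: n; exact: near_ln_ge.
by move=> h; rewrite ler_ln ?posrE ?expR_gt0// (lt_le_trans (expR_gt0 a)).
Unshelve. all: by end_near. Qed.

(** Between consecutive powers of two [ln n] moves by at most [ln 2], and [ln ln n] stays within a
    constant of [ln k]. The constants are crude, since any bounded error is later absorbed into a
    multiple of [ln ln n]. *)
Lemma trunc_log_ln (n : nat) (k := trunc_log 2 n) : (2 <= n)%N ->
  [/\ k%:R * ln 2 <= ln (n%:R : R), ln (n%:R : R) <= k.+1%:R * ln 2,
      ln (k%:R : R) <= ln (ln n%:R) + 1, ln (k.+1%:R : R) <= ln (ln n%:R) + 2 &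
      ln (ln (n%:R : R)) <= ln k%:R + 1].
Proof.
move=> n2; have n0 : (0 < n)%N by apply: leq_trans n2.
have k0 : (0 < k)%N by rewrite -(@trunc_expnK 2 1)// leq_trunc_log.
have /andP[h1 h2] : (2 ^ k <= n < 2 ^ k.+1)%N by exact: trunc_log_bounds.
have a2 := @ln2_ge_half R; have a1 := @ln2_le1 R.
have kp : 0 < k%:R :> R by rewrite ltr0n.
have l1 : k%:R * ln 2 <= ln (n%:R : R).
  by rewrite -[leLHS]expRK -pow2E ler_ln ?posrE ?ltr0n ?expn_gt0// ler_nat.
have l2 : ln (n%:R : R) <= k.+1%:R * ln 2.
  by rewrite -[leRHS]expRK -pow2E ler_ln ?posrE ?ltr0n ?expn_gt0// ler_nat ltnW.
have lnn : 0 < ln (n%:R : R) by apply: lt_le_trans l1; rewrite mulr_gt0//; lra.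
have l3 : ln (k%:R : R) <= ln (ln n%:R) + 1.
  have : ln (k%:R / 2) <= ln (ln (n%:R : R)).
    rewrite ler_ln ?posrE ?divr_gt0//; apply: le_trans l1.
    by rewrite ler_pM2l.
  rewrite ln_div ?posrE//; lra.
have l4 : ln (k.+1%:R : R) <= ln k%:R + 1.
  apply: le_trans (_ : ln (k%:R * 2 : R) <= _).
    by rewrite ler_ln ?posrE ?mulr_gt0// -natrM ler_nat; lia.
  by rewrite lnM ?posrE//; lra.
split=> //; first by lra.
apply: le_trans l4; rewrite ler_ln ?posrE//; apply: le_trans l2 _.
by rewrite ler_piMr.
Qed.

End loglog.

(** * Frontier bounds along all times *)

Section frontier_asymptotics.
Context {R : realType} {d' : nat} {dT : measure_display} {T : measurableType dT}
  {P : probability T R}.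
Local Notation d := d'.+1.
Context {X : nat -> 'I_d -> {RV P >-> R}}.
Hypothesis indepX : mutually_independent (fun ij : nat * 'I_d => X ij.1 ij.2).
Hypothesis expX : forall (i : nat) (j : 'I_d) (A : set R), measurable A ->
  distribution P (X i j) A = exponential_prob (1 : R) A.

(** Strictness in these four exceptional events follows the criteria for [c <= Fminus] and
    [c < Fplus]. *)
Definition Fminus_low (e : R) (n : nat) :=
  [set w | Fminus (sample X w) n < ln n%:R - e * ln (ln n%:R)].
Definition Fminus_high (e : R) (n : nat) :=
  [set w | ln n%:R + e * ln (ln n%:R) <= Fminus (sample X w) n].
Definition Fplus_low (s : R) (n : nat) :=
  [set w | Fplus (sample X w) n <= ln n%:R + s * ln (ln n%:R)].
Definition Fplus_high (s : R) (n : nat) :=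
  [set w | ln n%:R + s * ln (ln n%:R) < Fplus (sample X w) n].

(** The same events at time [2^k], with [ln ln n] replaced by [ln k], from which it differs by the
    constant [ln (ln 2)]. *)
Let dyadic_Fminus_low (e : R) (k : nat) :=
  [set w | Fminus (sample X w) (2 ^ k) < k%:R * ln 2 - e * ln k%:R].
Let dyadic_Fminus_high (e : R) (k : nat) :=
  [set w | k%:R * ln 2 + e * ln k%:R <= Fminus (sample X w) (2 ^ k)].
Let dyadic_Fplus_low (s : R) (k : nat) :=
  [set w | Fplus (sample X w) (2 ^ k) <= k%:R * ln 2 + s * ln k%:R].
Let dyadic_Fplus_high (s : R) (k : nat) :=
  [set w | k%:R * ln 2 + s * ln k%:R < Fplus (sample X w) (2 ^ k)].

(** Both ends of the frontier are nondecreasing in [n]: a low value at [n] persists at the power of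
    two before it, and a high value at the one after it. Halving [e] absorbs the bounded errors of
    rounding. *)
Lemma Fminus_low_dyadic (e : R) : 0 < e -> \forall n \near \oo,
  Fminus_low e n `<=` dyadic_Fminus_low (e / 2) (trunc_log 2 n).
Proof.
move=> e0; near=> n.
have n2 : (2 <= n)%N by near: n; exact: nbhs_infty_ge.
(* Amounts to [(e / 2) lnln n >= 1 + e / 2]: the 1 bounds [ln 2], and [e / 2] pays for
   [ln k <= lnln n + 1]. *)
have hl : (2 + e) / e <= ln (ln (n%:R : R)) by near: n; exact: near_lnln_ge.
have [l1 l2 l3 l4 l5] := @trunc_log_ln R n n2.
have a1 := @ln2_le1 R.
move=> w /=; rewrite /Fminus_low /dyadic_Fminus_low/= => h.
apply: le_lt_trans (Fminus_nondecreasing (sample X w) _ _ isT (trunc_logP _ _)) _ => //.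
  by apply: leq_trans n2.
apply: lt_le_trans h _.
rewrite ler_pdivrMr// in hl.
have := ler_wpM2l (ltW e0) l3; rewrite -natr1 mulrDl mul1r in l2; lra.
Unshelve. all: by end_near. Qed.

Lemma Fminus_high_dyadic (e : R) : 0 < e -> \forall n \near \oo,
  Fminus_high e n `<=` dyadic_Fminus_high (e / 2) (trunc_log 2 n).+1.
Proof.
move=> e0; near=> n.
have n2 : (2 <= n)%N by near: n; exact: nbhs_infty_ge.
have hl : (2 + 2 * e) / e <= ln (ln (n%:R : R)) by near: n; exact: near_lnln_ge.
have [l1 l2 l3 l4 l5] := @trunc_log_ln R n n2.
have a1 := @ln2_le1 R.
move=> w /=; rewrite /Fminus_high /dyadic_Fminus_high/= => h.
apply: le_trans (Fminus_nondecreasing (sample X w) n _ isT _).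
  apply: le_trans h.
  rewrite ler_pdivrMr// in hl.
  have := ler_wpM2l (ltW e0) l4; rewrite -natr1 mulrDl mul1r; lra.
by apply/ltnW/trunc_log_ltn.
Unshelve. all: by end_near. Qed.

Lemma Fplus_low_dyadic (e : R) : 0 < e -> \forall n \near \oo,
  Fplus_low (d'%:R - e) n `<=` dyadic_Fplus_low (d'%:R - e / 2) (trunc_log 2 n).
Proof.
move=> e0; near=> n.
have n2 : (2 <= n)%N by near: n; exact: nbhs_infty_ge.
have hl : (2 + 2 * d'%:R + 2 * e) / e <= ln (ln (n%:R : R)) - 1.
  rewrite lerBrDr; near: n; exact: near_lnln_ge.
have [l1 l2 l3 l4 l5] := @trunc_log_ln R n n2.
have a1 := @ln2_le1 R.
move=> w /=; rewrite /Fplus_low /dyadic_Fplus_low/= => h.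
apply: le_trans (Fplus_nondecreasing (sample X w) _ _ isT (trunc_logP _ _)) _ => //.
  by apply: leq_trans n2.
apply: le_trans h _.
rewrite ler_pdivrMr// in hl.
have := ler_wpM2l (ltW e0) l3; have := ler_wpM2l (ler0n R d') l5.
have := ler_wpM2l (ltW e0) l5.
rewrite -natr1 mulrDl mul1r in l2; lra.
Unshelve. all: by end_near. Qed.

Lemma Fplus_high_dyadic (s e : R) : 0 <= s -> 0 < e -> \forall n \near \oo,
  Fplus_high (s + e) n `<=` dyadic_Fplus_high (s + e / 2) (trunc_log 2 n).+1.
Proof.
move=> s0 e0; near=> n.
have n2 : (2 <= n)%N by near: n; exact: nbhs_infty_ge.
have hl : (2 + 4 * s + 2 * e) / e <= ln (ln (n%:R : R)) by near: n; exact: near_lnln_ge.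
have [l1 l2 l3 l4 l5] := @trunc_log_ln R n n2.
have a1 := @ln2_le1 R.
move=> w /=; rewrite /Fplus_high /dyadic_Fplus_high/= => h.
apply: lt_le_trans (Fplus_nondecreasing (sample X w) n _ isT _).
  apply: le_lt_trans h.
  rewrite ler_pdivrMr// in hl.
  have := ler_wpM2l (ltW e0) l4; have := ler_wpM2l s0 l4.
  rewrite -natr1 mulrDl mul1r; lra.
by apply/ltnW/trunc_log_ltn.
Unshelve. all: by end_near. Qed.

Lemma vanishing_Fminus_low (e : R) : 0 < e -> vanishing P (Fminus_low e).
Proof.
move=> e0; apply: vanishing_subseq near_trunc_log (Fminus_low_dyadic e e0) _.
apply: (vanishing_power P _ 1 2) => //.
under eq_near do rewrite mul1r.
by apply: prob_Fminus_lt_dyadic => //; rewrite divr_gt0.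
Qed.

Lemma ae_Fminus_low (e : R) : 0 < e -> ae_finally_not P (Fminus_low e).
Proof.
move=> e0; apply: ae_finally_not_subseq near_trunc_log (Fminus_low_dyadic e e0) _.
apply: (borel_cantelli_power P _ 1 1) => //.
under eq_near do rewrite mul1r.
by apply: prob_Fminus_lt_dyadic => //; rewrite divr_gt0.
Qed.

Lemma vanishing_Fminus_high (e : R) : 0 < e -> vanishing P (Fminus_high e).
Proof.
move=> e0; apply: vanishing_subseq near_trunc_logS (Fminus_high_dyadic e e0) _.
apply: (vanishing_power P _ 2 (e / 2 / 2)); first by rewrite !divr_gt0.
by apply: prob_Fminus_ge_dyadic1 => //; rewrite divr_gt0.
Qed.

Lemma ae_Fminus_high (e : R) : (0 < d')%N -> 0 < e -> ae_finally_not P (Fminus_high e).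
Proof.
move=> dd e0; apply: ae_finally_not_subseq near_trunc_logS (Fminus_high_dyadic e e0) _.
apply: (borel_cantelli_power P _ 2 1) => //.
by apply: prob_Fminus_ge_dyadic => //; rewrite divr_gt0.
Qed.

Lemma vanishing_Fplus_low (e : R) : 0 < e -> vanishing P (Fplus_low (d'%:R - e)).
Proof.
move=> e0; apply: vanishing_subseq near_trunc_log (Fplus_low_dyadic e e0) _.
apply: (vanishing_power P _ 1 2) => //.
under eq_near do rewrite mul1r.
by apply: prob_Fplus_le_dyadic => //; rewrite divr_gt0.
Qed.

Lemma ae_Fplus_low (e : R) : 0 < e -> ae_finally_not P (Fplus_low (d'%:R - e)).
Proof.
move=> e0; apply: ae_finally_not_subseq near_trunc_log (Fplus_low_dyadic e e0) _.
apply: (borel_cantelli_power P _ 1 1) => //.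
under eq_near do rewrite mul1r.
by apply: prob_Fplus_le_dyadic => //; rewrite divr_gt0.
Qed.

Lemma vanishing_Fplus_high (e : R) : 0 < e -> vanishing P (Fplus_high (d'%:R + e)).
Proof.
move=> e0.
apply: vanishing_subseq near_trunc_logS (Fplus_high_dyadic _ e (ler0n R d') e0) _.
apply: (vanishing_power P _ (3 ^+ d' * expR d'%:R) (e / 2)); first by rewrite divr_gt0.
have s0 : 0 <= d'%:R + e / 2 by rewrite addr_ge0// divr_ge0// ltW.
apply: filterS (prob_Fplus_gt_dyadic indepX expX _ s0) => k.
by rewrite addrAC subrr add0r.
Qed.

Lemma ae_Fplus_high (e : R) : 0 < e -> ae_finally_not P (Fplus_high (d%:R + e)).
Proof.
move=> e0.
apply: ae_finally_not_subseq near_trunc_logS (Fplus_high_dyadic _ e (ler0n R d) e0) _.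
apply: (borel_cantelli_power P _ (3 ^+ d' * expR d'%:R) (e / 2)); first by rewrite divr_gt0.
have s0 : 0 <= d%:R + e / 2 by rewrite addr_ge0// divr_ge0// ltW.
apply: filterS (prob_Fplus_gt_dyadic indepX expX _ s0) => k.
by rewrite (_ : d%:R + e / 2 - d'%:R = 1 + e / 2)// -natr1; ring.
Qed.

Lemma ae_io_Fplus_low (e : R) : 0 < e ->
  {ae P, forall w, forall N, exists2 n, (N <= n)%N & ~ Fplus_high (d'%:R + e) n w}.
Proof. by move=> e0; apply: vanishing_io; exact: vanishing_Fplus_high. Qed.

Lemma ae_io_Fplus_high (e : R) : 0 < e <= 1 ->
  {ae P, forall w, forall N, exists2 n, (N <= n)%N & ~ Fplus_low (d%:R - e) n w}.
Proof.
move=> e01.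
pose E k := [set w | forall i, (2 ^ k <= i < 2 ^ (k + k))%N ->
      ~ (strictly_below 0 (sample X w i) /\
         ln i.+1%:R + (d%:R - e) * ln (ln i.+1%:R) < coord_sum (sample X w i))].
have vE : vanishing P E.
  apply: (vanishing_power P _ 1 2) => //.
  under eq_near do rewrite mul1r.
  exact: (prob_no_large_sum_dyadic indepX expX).
apply: filterS (vanishing_io P E vE) => w hw N.
(* A large enough [k] gives [ln (i + 1) >= 1], so the threshold is nonnegative, as [Fplus_gtP]
   requires. *)
have [k Nk nE] := hw (maxn N 3).
have [i [ik pi ti]] : exists i, [/\ (2 ^ k <= i < 2 ^ (k + k))%N,
    strictly_below 0 (sample X w i) &
    ln i.+1%:R + (d%:R - e) * ln (ln i.+1%:R) < coord_sum (sample X w i)].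
  apply: contra_notP nE => nex i ik [pi ti].
  by apply: nex; exists i.
move/andP: ik => [i1 _].
(* Observation [i] enters the record-setting region at time [i + 1]. *)
exists i.+1.
  have kk : (k < 2 ^ k)%N by exact: ltn_expl.
  have NN : (N <= k)%N by exact: leq_trans (leq_maxl _ _) Nk.
  exact: leq_trans NN (leq_trans (ltnW kk) (leq_trans i1 (leqnSn i))).
rewrite /Fplus_low/=; apply/negP; rewrite -ltNge; apply/Fplus_gtP => //; last by exists i.
have a2 := @ln2_ge_half R.
have k2 : 2 <= k%:R :> R by rewrite ler_nat; apply: leq_trans Nk; rewrite leq_max orbT.
have l1 : 1 <= ln (i.+1%:R : R).
  apply: le_trans (_ : k%:R * ln 2 <= _).
    have := ler_wpM2l (ler0n R k) a2; lra.
  rewrite -[leLHS]expRK -pow2E ler_ln ?posrE ?ltr0n ?expn_gt0// ler_nat.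
  exact: leq_trans i1 (leqnSn i).
have de : 0 <= d%:R - e.
  by rewrite subr_ge0; move/andP: e01 => [_ e1]; apply: le_trans e1 _; rewrite ler1n.
have ll : 0 <= ln (ln (i.+1%:R : R)) by exact: ln_ge0.
by apply: addr_ge0; [exact: le_trans l1|exact: mulr_ge0].
Qed.

End frontier_asymptotics.

(** * Epsilon criteria for upper and lower limits *)

Section limsup_liminf.
Context {R : realType}.
Implicit Types (u : nat -> R) (l : R).

Lemma limn_esup_EFin u l :
  (forall e, 0 < e -> \forall n \near \oo, u n <= l + e) ->
  (forall e, 0 < e -> forall N, exists2 n, (N <= n)%N & l - e <= u n) ->
  limn_esup (fun n => (u n)%:E) = l%:E.
Proof.
move=> hle hge; apply/eqP; rewrite eq_le; apply/andP; split.
  apply/lee_addgt0Pr => e e0; rewrite -EFinD.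
  have [N _ hN] := hle e e0.
  apply: le_trans (_ : ereal_sup ((fun n => (u n)%:E) @` [set n | (N <= n)%N]) <= _)%E.
    by apply: ereal_inf_lbound; exists [set n | (N <= n)%N] => //; exists N.
  by apply: ge_ereal_sup => _ [n Nn <-]; rewrite lee_fin; exact: hN.
apply: le_ereal_inf_tmp => _ [V [N _ NV] <-].
apply/lee_addgt0Pr => e e0; rewrite -leeBlDr// -EFinB.
have [n Nn un] := hge e e0 N.
apply: le_trans (_ : (u n)%:E <= _)%E; first by rewrite lee_fin.
by apply: ereal_sup_ubound; exists n => //; exact: NV.
Qed.

Lemma limn_einf_EFin u l :
  (forall e, 0 < e -> \forall n \near \oo, l - e <= u n) ->
  (forall e, 0 < e -> forall N, exists2 n, (N <= n)%N & u n <= l + e) ->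
  limn_einf (fun n => (u n)%:E) = l%:E.
Proof.
move=> hge hle; rewrite /limn_einf.
have -> : (\- (fun n => (u n)%:E))%E = (fun n => (- u n)%:E) by [].
rewrite (limn_esup_EFin (fun n => - u n) (- l)); first by rewrite EFinN oppeK.
- move=> e /hge; apply: filterS => n; lra.
- move=> e e0 N; have [n Nn h] := hle e e0 N; exists n => //; lra.
Qed.

End limsup_liminf.

(** * Asymptotics of the width *)

Section width_asymptotics.
Context {R : realType} {d' : nat} {dT : measure_display} {T : measurableType dT}
  {P : probability T R}.
Local Notation d := d'.+1.
Context {X : nat -> 'I_d -> {RV P >-> R}}.
Hypothesis indepX : mutually_independent (fun ij : nat * 'I_d => X ij.1 ij.2).
Hypothesis expX : forall (i : nat) (j : 'I_d) (A : set R), measurable A ->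
  distribution P (X i j) A = exponential_prob (1 : R) A.

(** Outside the four exceptional events at level [eps / 2], the errors of [Fplus] and [Fminus] add
    up to at most [eps lnln n]. *)
Lemma width_cvg_probability (eps : R) : 0 < eps ->
  (fun n : nat => P [set w | eps < `| width X n w / ln (ln n%:R) - d'%:R |])
    @ \oo --> 0%E.
Proof.
move=> eps0; have e0 : 0 < eps / 2 by rewrite divr_gt0.
have v := vanishing_setU _ _ _
  (vanishing_setU _ _ _ (vanishing_Fminus_low indepX expX _ e0)
     (vanishing_Fminus_high indepX expX _ e0))
  (vanishing_setU _ _ _ (vanishing_Fplus_low indepX expX _ e0)
     (vanishing_Fplus_high indepX expX _ e0)).
have mW n : measurable [set w | eps < `| width X n w / ln (ln n%:R) - d'%:R |].
  exact: measurable_width_deviation.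
apply/fine_cvgP; split.
  by apply: nearW => n; rewrite fin_num_measure.
apply/cvgrPdist_le => r r0; near=> n.
rewrite sub0r normrN /= ger0_norm; last exact: fine_ge0.
rewrite -lee_fin fineK ?fin_num_measure//.
apply: prob_leP => //; apply: prob_leS (near (v r r0) n _) => //.
have l1 : 1 <= ln (ln (n%:R : R)) by near: n; exact: near_lnln_ge.
have l0 : 0 < ln (ln (n%:R : R)) by lra.
move=> w /=; apply: contraPP => /not_orP[/not_orP[]].
rewrite /Fminus_low /Fminus_high /Fplus_low /Fplus_high/=.
move=> /negP + /negP + /not_orP[/negP + /negP].
rewrite -!leNgt -!ltNge => h1 h2 h3 h4; apply/negP; rewrite -leNgt.
rewrite ler_norml lerBrDr lerBlDr ler_pdivlMr// ler_pdivrMr// /width.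
by apply/andP; split; lra.
Unshelve. all: by end_near. Qed.

(** Almost surely [Fminus] stays within [e lnln n] of [ln n], so the oscillation of the width is
    that of [Fplus], whose coefficient of [lnln n] returns near [d'] and near [d] infinitely
    often. *)
Lemma ae_width_limits : (0 < d')%N ->
  {ae P, forall w,
     limn_einf (fun n : nat => (width X n w / ln (ln n%:R))%:E) = d'%:R%:E
     /\ limn_esup (fun n : nat => (width X n w / ln (ln n%:R))%:E) = d%:R%:E}.
Proof.
(* A countable family of tolerances, so that all the almost sure events can be intersected. *)
move=> dd; pose e (m : nat) : R := m.+1%:R^-1.
have e0 m : 0 < e m by rewrite invr_gt0.
have e1 m : 0 < e m <= 1 by rewrite e0 invf_le1// ler1n.
have e_le (r : R) : 0 < r -> exists m, e m * 2 <= r.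
  move=> r0; exists (Num.truncn (2 / r)).
  rewrite /e mulrC ler_pdivrMr// mulrC -ler_pdivrMr//; exact/ltW/truncnS_gt.
have := ae_foralln (fun m => ae_Fminus_low indepX expX _ (e0 m)).
apply: filter_app.
have := ae_foralln (fun m => ae_Fminus_high indepX expX _ dd (e0 m)).
apply: filter_app.
have := ae_foralln (fun m => ae_Fplus_low indepX expX _ (e0 m)).
apply: filter_app.
have := ae_foralln (fun m => ae_Fplus_high indepX expX _ (e0 m)).
apply: filter_app.
have := ae_foralln (fun m => ae_io_Fplus_low indepX expX _ (e0 m)).
apply: filter_app.
have := ae_foralln (fun m => ae_io_Fplus_high indepX expX _ (e1 m)).
apply: filterS => w io_high io_low Fp_high Fp_low Fm_high Fm_low.
split.
- apply: limn_einf_EFin => r r0; have [m em] := e_le r r0.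
  + near=> n.
    have l1 : 1 <= ln (ln (n%:R : R)) by near: n; exact: near_lnln_ge.
    have l0 : 0 < ln (ln (n%:R : R)) by lra.
    have /negP : ~ Fminus_high (X := X) (e m) n w by near: n; exact: Fm_high.
    have /negP : ~ Fplus_low (X := X) (d'%:R - e m) n w by near: n; exact: Fp_low.
    rewrite /Fplus_low /Fminus_high/=.
    rewrite -!ltNge => h3 h4.
    rewrite ler_pdivlMr// /width; have := ler_wpM2r (ltW l0) em; lra.
  + move=> N.
    have [M _ hM] := near_lnln_ge (1 : R); have [M' _ hM'] := Fm_low m.
    have [n] := io_low m (maxn N (maxn M M')).
    rewrite !geq_max => /and3P[Nn Mn M'n]; rewrite /Fplus_high/= => /negP.
    rewrite -leNgt => h1.
    have /negP := hM' n M'n; rewrite -leNgt => h2.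
    have l1 := hM n Mn; exists n => //=.
    have l0 : 0 < ln (ln (n%:R : R)) by apply: lt_le_trans l1.
    rewrite ler_pdivrMr// /width; have := ler_wpM2r (ltW l0) em; lra.
- apply: limn_esup_EFin => r r0; have [m em] := e_le r r0.
  + near=> n.
    have l1 : 1 <= ln (ln (n%:R : R)) by near: n; exact: near_lnln_ge.
    have l0 : 0 < ln (ln (n%:R : R)) by lra.
    have /negP : ~ Fminus_low (X := X) (e m) n w by near: n; exact: Fm_low.
    have /negP : ~ Fplus_high (X := X) (d%:R + e m) n w by near: n; exact: Fp_high.
    rewrite /Fplus_high /Fminus_low/= -!leNgt => h1 h2.
    rewrite ler_pdivrMr// /width; have := ler_wpM2r (ltW l0) em; lra.
  + move=> N.
    have [M _ hM] := near_lnln_ge (1 : R); have [M' _ hM'] := Fm_high m.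
    have [n] := io_high m (maxn N (maxn M M')).
    rewrite !geq_max => /and3P[Nn Mn M'n]; rewrite /Fplus_low/= => /negP.
    rewrite -ltNge => h1.
    have /negP := hM' n M'n; rewrite -ltNge => h2.
    have l1 := hM n Mn; exists n => //=.
    have l0 : 0 < ln (ln (n%:R : R)) by apply: lt_le_trans l1.
    rewrite ler_pdivlMr// /width; have := ler_wpM2r (ltW l0) em; lra.
Unshelve. all: by end_near. Qed.

End width_asymptotics.

Theorem theorem1p11 (R : realType) (d : nat) (dT : measure_display)
  (T : measurableType dT) (P : probability T R)
  (X : nat -> 'I_d -> {RV P >-> R}) :
  (1 <= d)%N ->
  mutually_independent (fun ij : nat * 'I_d => X ij.1 ij.2) ->
  (forall (i : nat) (j : 'I_d) (A : set R), measurable A ->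
     distribution P (X i j) A = exponential_prob (1 : R) A) ->
  (* (a) convergence in probability *)
  (forall eps : R, 0 < eps ->
     (fun n : nat => P [set w | eps <
        `| width X n w / ln (ln n%:R) - (d%:R - 1) |]) @ \oo --> 0%E)
  /\
  (* (b) almost sure liminf / limsup for d >= 2 *)
  ((2 <= d)%N ->
     {ae P, forall w,
        limn_einf (fun n : nat => (width X n w / ln (ln n%:R))%:E)
          = (d%:R - 1)%:E
        /\ limn_esup (fun n : nat => (width X n w / ln (ln n%:R))%:E)
          = (d%:R)%:E}).
Proof.
case: d X => [//|d'] X _ indepX expX.
have -> : d'.+1%:R - 1 = d'%:R :> R by rewrite -natr1 addrK.
split; first by move=> eps; exact: width_cvg_probability.
by move=> d2; exact: ae_width_limits.
Qed.
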